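(* Let $\kappa>0$, let $p\ge 0$ be an integer, and let $K\subset\mathbb{R}^3$ be a (nondegenerate) tetrahedron with set of faces $\mathcal{F}_K$. Then the local problem on $K$ (stated in the context) is well-posed: for every choice of data $\boldsymbol{g}^\ominus_{K,F}\in\boldsymbol{\mathcal{P}}_p^t(F)$, $F\in\mathcal{F}_K$, there exists exactly one pair $(\boldsymbol{e}_K,\boldsymbol{h}_K)\in\boldsymbol{\mathcal{P}}_p(K)\times\boldsymbol{\mathcal{P}}_p(K)$ solving it.
   Context: Notation. $\imath$ is the imaginary unit. $\boldsymbol{\mathcal{P}}_p(K)$ (resp. $\boldsymbol{\mathcal{P}}_p(F)$) is the space of $\mathbb{C}^3$-valued polynomials of degree at most $p$ on the tetrahedron $K$ (resp. on the planar face $F$). For $F\in\mathcal{F}_K$, $\boldsymbol{n}_{K,F}\in\mathbb{R}^3$ is the unit normal to $F$ outward to $K$. The tangential trace space is $\boldsymbol{\mathcal{P}}_p^t(F)=\{\boldsymbol{v}\in\boldsymbol{\mathcal{P}}_p(F) : \boldsymbol{n}_{K,F}\cdot\boldsymbol{v}=0\}$. For $\boldsymbol{v}\in\boldsymbol{\mathcal{P}}_p(K)$, its tangential trace on $F$ is $\boldsymbol{n}_{K,F}\times\boldsymbol{v}|_F$ and its tangential component trace is $\boldsymbol{\pi}^t_{K,F}(\boldsymbol{v})=-\boldsymbol{n}_{K,F}\times(\boldsymbol{n}_{K,F}\times\boldsymbol{v}|_F)$; both belong to $\boldsymbol{\mathcal{P}}_p^t(F)$. Sesquilinear forms: $(\boldsymbol{v},\boldsymbol{w})_K=\int_K\boldsymbol{v}\cdot\overline{\boldsymbol{w}}\,d\boldsymbol{x}$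 and $\langle\boldsymbol{v},\boldsymbol{w}\rangle_F=\int_F\boldsymbol{v}\cdot\overline{\boldsymbol{w}}\,d\sigma$, where $\cdot$ is the bilinear dot product. Local problem on $K$: given $\boldsymbol{g}^\ominus_{K,F}\in\boldsymbol{\mathcal{P}}_p^t(F)$ for all $F\in\mathcal{F}_K$, find $(\boldsymbol{e}_K,\boldsymbol{h}_K)\in\boldsymbol{\mathcal{P}}_p(K)\times\boldsymbol{\mathcal{P}}_p(K)$ such that for all $(\boldsymbol{v}_K,\boldsymbol{w}_K)\in\boldsymbol{\mathcal{P}}_p(K)\times\boldsymbol{\mathcal{P}}_p(K)$, $$\imath\kappa(\boldsymbol{e}_K,\boldsymbol{v}_K)_K-(\boldsymbol{h}_K,\nabla\times\boldsymbol{v}_K)_K+\sum_{F\in\mathcal{F}_K}\Big\langle\tfrac12\boldsymbol{g}^\oplus_{K,F}(\boldsymbol{e}_K,\boldsymbol{h}_K),\boldsymbol{\pi}^t_{K,F}(\boldsymbol{v}_K)\Big\rangle_F=\sum_{F\in\mathcal{F}_K}\Big\langle\tfrac12\boldsymbol{g}^\ominus_{K,F},\boldsymbol{\pi}^t_{K,F}(\boldsymbol{v}_K)\Big\rangle_F,$$ $$\imath\kappa(\boldsymbol{h}_K,\boldsymbol{w}_K)_K+(\boldsymbol{e}_K,\nabla\times\boldsymbol{w}_K)_K+\sum_{F\in\mathcal{F}_K}\Big\langle\tfrac12\boldsymbol{n}_{K,F}\times\boldsymbol{g}^\oplus_{K,F}(\boldsymbol{e}_K,\boldsymbol{h}_K),\boldsymbol{\pi}^t_{K,F}(\boldsymbol{w}_K)\Big\rangle_F=-\sum_{F\in\mathcal{F}_K}\Big\langle\tfrac12\boldsymbol{n}_{K,F}\times\boldsymbol{g}^\ominus_{K,F},\boldsymbol{\pi}^t_{K,F}(\boldsymbol{w}_K)\Big\rangle_F,$$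 where $\boldsymbol{g}^\oplus_{K,F}(\boldsymbol{e}_K,\boldsymbol{h}_K)=\boldsymbol{\pi}^t_{K,F}(\boldsymbol{e}_K)-\boldsymbol{n}_{K,F}\times\boldsymbol{h}_K$. *)

(* Defs.v *)
From HB Require Import structures.
From mathcomp Require Import all_boot all_order all_algebra.
From mathcomp Require Import complex.
From mathcomp Require Import ring.
From mathcomp Require Import all_classical all_reals all_analysis.
(* The notations of mpoly clash with those of analysis. *)
From mathcomp Require Import -(notations) mpoly.

Set Implicit Arguments.
Unset Strict Implicit.
Unset Printing Implicit Defensive.

Import Order.TTheory GRing.Theory Num.Theory.
Local Open Scope classical_set_scope.
Local Open Scope ring_scope.
Local Open Scope complex_scope.

(* The dot product is bilinear, also over the complex numbers. *)
Definition dot (A : comNzRingType) (u v : 'rV[A]_3) : A :=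
  \sum_k u 0 k * v 0 k.

(* Indices k + 1 and k + 2 are computed in 'I_3, i.e. modulo 3. *)
Definition cross (A : comNzRingType) (u v : 'rV[A]_3) : 'rV[A]_3 :=
  \row_k (u 0 (k + 1) * v 0 (k + 2) - u 0 (k + 2) * v 0 (k + 1)).

(* Euclidean norm; `|u| is the sup norm. *)
Definition norm2 (R : rcfType) (u : 'rV[R]_3) : R := Num.sqrt (dot u u).

Definition cvec (R : rcfType) (u : 'rV[R]_3) : 'rV[R[i]]_3 :=
  map_mx (real_complex R) u.

Section Polynomials.
Variable R : rcfType.

(* C^3-valued polynomials in the three coordinates. *)
Definition vpoly := 'rV[mpoly 3 R[i]]_3.

(* msize is one more than the total degree, and 0 on the zero polynomial. *)
Definition vpoly_deg_le (p : nat) (v : vpoly) : Prop :=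
  forall k, (msize (v 0%R k) <= p.+1)%N.

Definition veval (v : vpoly) (x : 'rV[R]_3) : 'rV[R[i]]_3 :=
  \row_k meval (cvec x 0) (v 0 k).

Definition curl (v : vpoly) : vpoly :=
  \row_k (mderiv (k + 1) (v 0 (k + 2)) - mderiv (k + 2) (v 0 (k + 1))).

End Polynomials.

Section Tetrahedron.
Variables (R : realType) (a : 'I_4 -> 'rV[R]_3).

Definition tetra_nondegenerate : Prop :=
  \det (\matrix_(j < 3) (a (lift ord0 j) - a ord0)) != 0.

Definition tetrahedron : set 'rV[R]_3 :=
  [set x | exists t : 'I_4 -> R,
    [/\ forall j, 0 <= t j, \sum_j t j = 1 & x = \sum_j t j *: a j]].

(* Face i is the one opposite to the vertex a i. *)
Definition face (i : 'I_4) : set 'rV[R]_3 :=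
  [set x | exists t : 'I_4 -> R,
    [/\ forall j, 0 <= t j, \sum_j t j = 1, t i = 0 & x = \sum_j t j *: a j]].

Definition face_vertex (i : 'I_4) (j : 'I_3) : 'rV[R]_3 := a (lift i j).

Definition face_edge1 (i : 'I_4) := face_vertex i 1 - face_vertex i 0.
Definition face_edge2 (i : 'I_4) := face_vertex i 2 - face_vertex i 0.

(* A vector normal to face i, of norm twice the area of that face. *)
Definition face_cross (i : 'I_4) := cross (face_edge1 i) (face_edge2 i).

(* Unit outward normal to face i (face_normalP below): the sign makes it
   point away from the opposite vertex a i. *)
Definition face_normal (i : 'I_4) : 'rV[R]_3 :=
  - (Num.sg (dot (face_cross i) (a i - face_vertex i 0))
       / norm2 (face_cross i)) *: face_cross i.

Lemma dotE u v :
  dot u v = u 0 0 * v 0 0 + u 0 1 * v 0 1 + u 0 2 * v 0 2 :> R.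
Proof.
rewrite /dot !big_ord_recl big_ord0 addr0 addrA.
by congr (_ + _ * _ + _ * _); congr (_ _ _); apply/val_inj.
Qed.

Lemma crossE (u v : 'rV[R]_3) :
  [/\ cross u v 0 0 = u 0 1 * v 0 2 - u 0 2 * v 0 1,
      cross u v 0 1 = u 0 2 * v 0 0 - u 0 0 * v 0 2 &
      cross u v 0 2 = u 0 0 * v 0 1 - u 0 1 * v 0 0].
Proof.
by split; rewrite mxE; congr (_ * _ - _ * _); congr (_ _ _); apply/val_inj.
Qed.

Lemma det_rows (f : 'I_3 -> 'rV[R]_3) :
  \det (\matrix_(j < 3) f j) = dot (cross (f 1) (f 2)) (f 0).
Proof.
rewrite dotE; have [-> -> ->] := crossE (f 1) (f 2).
have [G GE] : exists G, forall i j, f i 0 j = G i (nat_of_ord j) :> R.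
  by exists (fun i k => f i 0 (inord k)) => i' j; rewrite inord_val.
rewrite (expand_det_row _ 0) !big_ord_recl big_ord0 /cofactor.
rewrite !(expand_det_row _ (0 : 'I_2)) !big_ord_recl !big_ord0 /cofactor.
rewrite !det_mx11 !mxE.
rewrite (_ : lift ord0 ord0 = 1 :> 'I_3); last exact/val_inj.
rewrite (_ : lift ord0 (lift ord0 ord0) = 2 :> 'I_3); last exact/val_inj.
rewrite !GE /= /bump /=.
ring.
Qed.

Lemma face_cross_det i :
  dot (face_cross i) (a i - face_vertex i 0) ^+ 2 =
  \det (\matrix_(j < 3) (a (lift ord0 j) - a ord0)) ^+ 2.
Proof.
rewrite det_rows /face_cross !dotE.
have [-> -> ->] := crossE (face_edge1 i) (face_edge2 i).
have [-> -> ->] := crossE (a (lift ord0 1) - a ord0) (a (lift ord0 2) - a ord0).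
rewrite /face_edge1 /face_edge2 /face_vertex !mxE.
have L (j : 'I_4) (k : 'I_3) : a (lift j k) = a (inord (bump j k)).
  by congr a; apply/val_inj; rewrite /= inordK//; exact: (ltn_ord (lift j k)).
have L0 (j : 'I_4) : a j = a (inord j) by rewrite inord_val.
rewrite !L (L0 i) (L0 ord0).
by case: i => [[|[|[|[|//]]]] hi] /=; ring.
Qed.

Lemma dotC u v : dot u v = dot v u :> R.
Proof. by apply: eq_bigr => k _; rewrite mulrC. Qed.

Lemma dotZ c u v : dot (c *: u) v = c * dot u v :> R.
Proof. by rewrite /dot mulr_sumr; apply: eq_bigr => k _; rewrite mxE mulrA. Qed.

Lemma dotB u v w : dot u (v - w) = dot u v - dot u w :> R.
Proof.
by rewrite /dot -sumrB; apply: eq_bigr => k _; rewrite !mxE mulrBr.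
Qed.

Lemma dot_suml u (t : 'I_4 -> R) :
  dot u (\sum_j t j *: a j) = \sum_j t j * dot u (a j).
Proof.
rewrite dotC /dot; under eq_bigr => k _ do rewrite summxE mulr_suml.
rewrite exchange_big; apply: eq_bigr => j _ /=; rewrite mulr_sumr.
by apply: eq_bigr => k _; rewrite mxE mulrAC mulrA.
Qed.

Lemma face_cross_orth i j :
  dot (face_cross i) (face_vertex i j - face_vertex i 0) = 0.
Proof.
rewrite dotE /face_cross; have [-> -> ->] := crossE (face_edge1 i) (face_edge2 i).
rewrite /face_edge1 /face_edge2 !mxE.
have [->|->|->] : [\/ j = 0, j = 1 | j = 2].
  by case: j => [[|[|[|//]]] h]; [constructor 1|constructor 2|constructor 3];
     apply/val_inj.
all: ring.
Qed.

Lemma face_normalP i : tetra_nondegenerate ->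
  [/\ dot (face_normal i) (face_normal i) = 1,
      forall x y, face i x -> face i y -> dot (face_normal i) (x - y) = 0 &
      forall x y, tetrahedron x -> face i y ->
        dot (face_normal i) (x - y) <= 0].
Proof.
rewrite /tetra_nondegenerate => nd.
set c := face_cross i; set D := dot c (a i - face_vertex i 0).
have D0 : D != 0 by rewrite -sqrf_eq0 face_cross_det sqrf_eq0.
have cc_ge0 : 0 <= dot c c by apply: sumr_ge0 => k _; rewrite -expr2 sqr_ge0.
have cc0 : dot c c != 0.
  apply: contra D0; rewrite psumr_eq0; last by move=> k _; rewrite -expr2 sqr_ge0.
  move=> /allP z; rewrite /D /dot big1// => k _.
  by have := z k (mem_index_enum k); rewrite mulf_eq0 orbb => /eqP ->; rewrite mul0r.
have aff (t : 'I_4 -> R) : \sum_j t j = 1 ->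
    dot c (\sum_j t j *: a j) = t i * D + dot c (face_vertex i 0).
  move=> t1; rewrite dot_suml -[dot c (face_vertex i 0)]mul1r -t1 mulr_suml.
  apply/eqP; rewrite -subr_eq -sumrB (bigD1 i)//= -mulrBr -dotB -/D.
  rewrite big1 ?addr0// => j ji; rewrite -mulrBr -dotB.
  move: ji; rewrite eq_sym => /unlift_some[l -> _].
  by rewrite -/(face_vertex i l) face_cross_orth mulr0.
have nD : Num.sg D / norm2 c * D >= 0.
  by rewrite mulrAC -normrEsg divr_ge0// sqrtr_ge0.
rewrite /face_normal -/c -/D; split.
- rewrite dotZ dotC dotZ mulrA mulrNN mulrACA -expr2 sqr_sg D0 mul1r.
  by rewrite -invfM -expr2 sqr_sqrtr// mulVf.
- move=> x y [t [_ t1 ti ->]] [s [_ s1 si ->]].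
  by rewrite dotZ dotB !aff// ti si subrr mulr0.
- move=> x y [t [t0 t1 ->]] [s [_ s1 si ->]].
  rewrite dotZ dotB !aff// si mul0r add0r addrK mulNr oppr_le0 mulrCA.
  exact: mulr_ge0.
Qed.

End Tetrahedron.

Section Integration.
Variable R : realType.
Local Notation mu := (@lebesgue_measure R).

Definition Cintegral d (T : measurableType d) (m : {measure set T -> \bar R})
    (D : set T) (f : T -> R[i]) : R[i] :=
  (\int[m]_(x in D) complex.Re (f x))
    +i* (\int[m]_(x in D) complex.Im (f x)).

Definition vec3 (t : R * R * R) : 'rV[R]_3 :=
  \row_k nth 0 [:: t.1.1; t.1.2; t.2] k.

Definition integral_vol (a : 'I_4 -> 'rV[R]_3) (f : 'rV[R]_3 -> R[i]) : R[i] :=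
  Cintegral (mu \x mu \x mu)%E (vec3 @^-1` tetrahedron a) (f \o vec3).

Definition unit_triangle : set (R * R) :=
  [set s | [/\ 0 <= s.1, 0 <= s.2 & s.1 + s.2 <= 1]].

Definition face_param (a : 'I_4 -> 'rV[R]_3) (i : 'I_4) (s : R * R) :
  'rV[R]_3 := face_vertex a i 0 + s.1 *: face_edge1 a i + s.2 *: face_edge2 a i.

(* Surface integral over face i: the affine parametrization of the face has
   constant area density, the norm of the cross product of the two edges. *)
Definition integral_face (a : 'I_4 -> 'rV[R]_3) (i : 'I_4)
    (f : 'rV[R]_3 -> R[i]) : R[i] :=
  (norm2 (face_cross a i))%:C *
    Cintegral (mu \x mu)%E unit_triangle (f \o face_param a i).

Definition inner_vol (a : 'I_4 -> 'rV[R]_3) (v w : 'rV[R]_3 -> 'rV[R[i]]_3) :=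
  integral_vol a (fun x => dot (v x) (map_mx conjc (w x))).

Definition inner_face (a : 'I_4 -> 'rV[R]_3) (i : 'I_4)
    (v w : 'rV[R]_3 -> 'rV[R[i]]_3) :=
  integral_face a i (fun x => dot (v x) (map_mx conjc (w x))).

End Integration.

Section LocalProblem.
Variables (R : realType) (kappa : R) (p : nat) (a : 'I_4 -> 'rV[R]_3).

Definition ncross (i : 'I_4) (u : 'rV[R[i]]_3) : 'rV[R[i]]_3 :=
  cross (cvec (face_normal a i)) u.

Definition tan_comp (i : 'I_4) (u : 'rV[R[i]]_3) : 'rV[R[i]]_3 :=
  - ncross i (ncross i u).

(* Tangential polynomial fields of degree at most p on face i, as functions
   that matter only on the face. Since the face is planar, polynomials on it
   are the restrictions of polynomials in the three coordinates. *)
Definition tangential_poly (i : 'I_4) (g : 'rV[R]_3 -> 'rV[R[i]]_3) : Prop :=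
  (exists q : vpoly R, vpoly_deg_le p q /\ {in face a i, g =1 veval q}) /\
  {in face a i, forall x, dot (cvec (face_normal a i)) (g x) = 0}.

Definition gplus (i : 'I_4) (e h : vpoly R) (x : 'rV[R]_3) : 'rV[R[i]]_3 :=
  tan_comp i (veval e x) - ncross i (veval h x).

Definition local_eq1 (g : 'I_4 -> 'rV[R]_3 -> 'rV[R[i]]_3) (e h v : vpoly R) :=
  (0 +i* kappa) * inner_vol a (veval e) (veval v)
  - inner_vol a (veval h) (veval (curl v))
  + \sum_i inner_face a i (fun x => 2^-1 *: gplus i e h x)
             (fun x => tan_comp i (veval v x))
  = \sum_i inner_face a i (fun x => 2^-1 *: g i x)
             (fun x => tan_comp i (veval v x)).

Definition local_eq2 (g : 'I_4 -> 'rV[R]_3 -> 'rV[R[i]]_3) (e h w : vpoly R) :=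
  (0 +i* kappa) * inner_vol a (veval h) (veval w)
  + inner_vol a (veval e) (veval (curl w))
  + \sum_i inner_face a i (fun x => 2^-1 *: ncross i (gplus i e h x))
             (fun x => tan_comp i (veval w x))
  = - \sum_i inner_face a i (fun x => 2^-1 *: ncross i (g i x))
               (fun x => tan_comp i (veval w x)).

Definition local_solution (g : 'I_4 -> 'rV[R]_3 -> 'rV[R[i]]_3)
    (e h : vpoly R) : Prop :=
  [/\ vpoly_deg_le p e, vpoly_deg_le p h &
      forall v w : vpoly R, vpoly_deg_le p v -> vpoly_deg_le p w ->
        local_eq1 g e h v /\ local_eq2 g e h w].

End LocalProblem.

(* Main.v *)
From HB Require Import structures.
Require Import Defs.
From mathcomp Require Import all_boot all_order all_algebra all_fingroup.
From mathcomp Require Import complex.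
From mathcomp Require Import all_classical all_reals all_analysis.
From mathcomp Require Import measurable_realfun ring lra.
From mathcomp Require Import -(notations) mpoly.

(** The local problem is a square linear system: both the unknown and the test
    functions are pairs of fields of degree at most p. So it is well posed as
    soon as its homogeneous version has only the zero solution
    ([injective_system_solvable]).

    Let (e, h) solve the homogeneous problem. Test the first equation with e, the
    second with h, add them and take the real part. The terms in i kappa are
    imaginary. By Green's formula for the curl ([curl_by_parts]), the curl terms
    leave the real part of the sum over the faces of the products of n x h with
    e, and this is what the mixed terms of the fluxes cancel. What remains is half
    the sum of the squared norms of the tangential components of e and h on
    the faces ([energy_identity]), so these components vanish. Integrating by
    parts once more, now without boundary terms, the equations say that
    i kappa e - curl h and i kappa h + curl e are orthogonal to all fields of
    degree at most p. They are such fields themselves, hence zero. But the curl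
    lowers the degree, so e and h, each a multiple of the curl of the other, can
    have no degree at all ([homogeneous_eq0]).

    This uses two facts about integrals of polynomials over the tetrahedron K.
    One is definiteness: a polynomial whose squared modulus has integral zero
    vanishes on an open set, hence is zero ([vol_int_eq0]). The other is
    the divergence theorem ([divergence]), and it is enough to prove it for
    derivatives along three independent edges. Take an edge from a_r to a_(r+1).
    The tetrahedron is a union of segments parallel to it, which start on the
    face opposite to a_(r+1) and end on the face opposite to a_r
    ([tetra_fiber]). Thanks to the consecutive indices, the parametrizations of
    the two faces by the reference triangle match along these segments, so that
    the fundamental theorem of calculus on each segment and Fubini over the
    triangle give the two surface integrals ([integral_slab]). The passage from K
    to these coordinates is an affine change of variables ([integral_affine3]),
    obtained by factoring a matrix into maps that change one coordinate only. *)

Set Implicit Arguments.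
Unset Strict Implicit.
Unset Printing Implicit Defensive.

Import Order.TTheory GRing.Theory Num.Theory.
Import numFieldNormedType.Exports.
Local Open Scope classical_set_scope.
Local Open Scope ring_scope.
Local Open Scope complex_scope.

(** * Lebesgue measure under affine maps of space *)

Lemma ord3P (k : 'I_3) : [\/ k = 0, k = 1 | k = 2].
Proof.
by case: k => -[|[|[|//]]] h; [constructor 1|constructor 2|constructor 3];
  apply/val_inj.
Qed.

Lemma sum_ord3 (V : nmodType) (f : 'I_3 -> V) : \sum_k f k = f 0 + f 1 + f 2.
Proof.
rewrite !big_ord_recl big_ord0 addr0 addrA.
by congr (_ + f _ + f _); apply/val_inj.
Qed.

Section Affine1.
Variable R : realType.
Local Notation mu := (@lebesgue_measure R).

(** By uniqueness of the Lebesgue measure it is enough to look at half-open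
    intervals; for negative c their preimages are open on the right. *)
Lemma lebesgue_measure_affine (c t : R) (A : set R) : c != 0 -> measurable A ->
  mu ((fun x => c * x + t) @^-1` A) = (`|c|^-1%:E * mu A)%E.
Proof.
move=> c0 mA.
pose f (x : R) : measurableTypeR R := c * x + t.
have mf : measurable_fun setT f.
  by apply: measurable_funD => //; exact: mulrl_measurable.
pose nu : {measure set (measurableTypeR R) -> \bar R} :=
  mscale (NngNum (normr_ge0 c)) (pushforward mu f).
have -> : mu A = nu mf A.
  apply: (@lebesgue_measure_unique R (nu mf)) => // _ [[u v]] _ <-.
  change (mu `]u, v]%classic = (`|c|%:E * mu (f @^-1` `]u, v]%classic))%E).
  have -> : f @^-1` `]u, v] = if 0 < c then `]((u - t) / c), ((v - t) / c)]%classic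
      else `[((v - t) / c), ((u - t) / c)[%classic.
    have [c_gt0|c_le0] := ltP 0 c; apply/seteqP; split => x /=; rewrite !in_itv /= /f.
    - by rewrite ltr_pdivrMr// ler_pdivlMr// ltrBlDr lerBrDr mulrC.
    - by rewrite ltr_pdivrMr// ler_pdivlMr// ltrBlDr lerBrDr mulrC.
    - have c_lt0 : c < 0 by rewrite lt_neqAle c0.
      by rewrite ltr_ndivlMr// ler_ndivrMr// ltrBlDr lerBrDr [x * c]mulrC andbC.
    - have c_lt0 : c < 0 by rewrite lt_neqAle c0.
      by rewrite ltr_ndivlMr// ler_ndivrMr// ltrBlDr lerBrDr [x * c]mulrC andbC.
  have [c_gt0|c_le0] := ltP 0 c; rewrite !lebesgue_measure_itv /= !lte_fin.
    rewrite ltr_pM2r ?invr_gt0// ltrD2r gtr0_norm//.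
    by case: ifP => _; rewrite ?mule0// -!EFinB -EFinM; congr (_%:E); field.
  have c_lt0 : c < 0 by rewrite lt_neqAle c0.
  rewrite ltr_nM2r ?invr_lt0// ltrD2r ltr0_norm//.
  by case: ifP => _; rewrite ?mule0// -!EFinB -EFinM; congr (_%:E); field.
by rewrite /nu /mscale /= muleA -EFinM mulVf ?normr_eq0// mul1e.
Qed.
End Affine1.

Section Skew.
Local Open Scope ereal_scope.
Variables (R : realType) (d1 d2 : measure_display).
Variables (T1 : measurableType d1) (T2 : measurableType d2).

(** Cavalieri: each vertical slice of the preimage is the preimage of a slice. *)
Lemma product_measure1_skew (m1 : {measure set T1 -> \bar R})
    (m2 : {sigma_finite_measure set T2 -> \bar R})
    (c : R) (tau : T1 -> T2 -> T2) E :
  (0 <= c)%R ->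
  (forall s B, measurable B -> m2 (tau s @^-1` B) = c%:E * m2 B) ->
  measurable E ->
  (m1 \x m2) ((fun x => (x.1, tau x.1 x.2)) @^-1` E) = c%:E * (m1 \x m2) E.
Proof.
move=> c0 tauP mE; rewrite /product_measure1 -ge0_integralZl//=.
- apply: eq_integral => s _ /=; rewrite -(tauP s); last exact: measurable_xsection.
  congr (m2 _); apply/seteqP; split => t /=; by rewrite /xsection /= !inE.
- exact: measurable_fun_xsection.
Qed.

(** Slicing the other way changes the order of integration, which is legitimate
    on measurable sets only: hence the measurability of the map. *)
Lemma product_measure2_skew (m1 : {sigma_finite_measure set T1 -> \bar R})
    (m2 : {sigma_finite_measure set T2 -> \bar R})
    (c : R) (tau : T2 -> T1 -> T1) E :
  (0 <= c)%R -> measurable_fun setT (fun x : T1 * T2 => (tau x.2 x.1, x.2)) ->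
  (forall t B, measurable B -> m1 (tau t @^-1` B) = c%:E * m1 B) ->
  measurable E ->
  (m1 \x m2) ((fun x => (tau x.2 x.1, x.2)) @^-1` E) = c%:E * (m1 \x m2) E.
Proof.
move=> c0 mT tauP mE.
have sw X : measurable X -> (m1 \x m2) X = (m1 \x^ m2) X.
  by move=> mX; apply: product_measure_unique => // A B mA mB;
     exact: product_measure2E.
rewrite !sw//; last by rewrite -[X in measurable X]setTI; exact: mT.
rewrite /product_measure2 -ge0_integralZl//=.
- apply: eq_integral => t _ /=; rewrite -(tauP t); last exact: measurable_ysection.
  congr (m1 _); apply/seteqP; split => s /=; by rewrite /ysection /= !inE.
- exact: measurable_fun_ysection.
Qed.
End Skew.

Section SigmaFiniteProduct.
Variable R : realType.
Context d1 d2 (T1 : measurableType d1) (T2 : measurableType d2).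
Variable m1 : {sigma_finite_measure set T1 -> \bar R}.
Variable m2 : {sigma_finite_measure set T2 -> \bar R}.

Lemma sigma_finite_product_measure1 : sigma_finite setT (m1 \x m2)%E.
Proof.
have /sigma_finiteP[F [FT ndF Foo]] := sigma_finiteT m1.
have /sigma_finiteP[G [GT ndG Goo]] := sigma_finiteT m2.
exists (fun n => F n `*` G n).
  apply/seteqP; split => // -[x y] _.
  have [i _ Fx] : (\bigcup_i F i) x by rewrite -FT.
  have [j _ Gy] : (\bigcup_j G j) y by rewrite -GT.
  exists (maxn i j) => //; split => /=.
    exact: (subsetPset _ _ (ndF _ _ (leq_maxl i j))).
  exact: (subsetPset _ _ (ndG _ _ (leq_maxr i j))).
move=> n; have [mF Fn] := Foo n; have [mG Gn] := Goo n.
split; first exact: measurableX.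
by rewrite product_measure1E// lte_mul_pinfty// ge0_fin_numE.
Qed.

(** The product measure packed with its sigma-finiteness, which the iterated
    slicing of space as a product of a plane and a line relies on. *)
Definition product_measure1_sfm : {sigma_finite_measure set (T1 * T2)%type -> \bar R} :=
  HB.pack (m1 \x m2)%E (@Measure_isSigmaFinite.Build _ _ _ (m1 \x m2)%E
    sigma_finite_product_measure1).
End SigmaFiniteProduct.

Section Linear3.
Variable R : realType.
Local Notation mu := (@lebesgue_measure R).
Local Notation mu3 := (mu \x mu \x mu)%E.
Implicit Types (A : 'M[R]_3) (u : 'rV[R]_3).

Definition unvec3 (x : 'rV[R]_3) : R * R * R := (x 0 0, x 0 1, x 0 2).

Lemma vec3K : cancel (@vec3 R) unvec3.
Proof. by case=> [[x y] z]; rewrite /unvec3 /vec3 !mxE. Qed.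

Lemma unvec3K : cancel unvec3 (@vec3 R).
Proof.
move=> x; apply/rowP => -[[|[|[|//]]] h]; rewrite mxE /=; congr (x 0 _);
exact/val_inj.
Qed.

(** Matrices act on row vectors, so that in a product the left factor acts
    first. *)
Definition lin3 A (x : R * R * R) : R * R * R := unvec3 (vec3 x *m A).

Lemma vec3_lin3 A x : vec3 (lin3 A x) = vec3 x *m A.
Proof. exact: unvec3K. Qed.

Lemma lin3E A x : lin3 A x =
  (x.1.1 * A 0 0 + x.1.2 * A 1 0 + x.2 * A 2 0,
   x.1.1 * A 0 1 + x.1.2 * A 1 1 + x.2 * A 2 1,
   x.1.1 * A 0 2 + x.1.2 * A 1 2 + x.2 * A 2 2).
Proof.
rewrite /lin3 /unvec3; congr (_, _, _).
all: rewrite !mxE !big_ord_recl big_ord0 addr0 addrA !mxE /=.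
all: by congr (_ + _ * _ + _ * _); congr (A _ _); apply/val_inj.
Qed.

Lemma measurable_vec3 k : measurable_fun setT (fun x : R * R * R => vec3 x 0 k).
Proof.
case: k => -[|[|[|//]]] h.
- apply: (eq_measurable_fun (fun x : R * R * R => x.1.1)).
    by move=> x _; rewrite mxE.
  exact: measurableT_comp.
- apply: (eq_measurable_fun (fun x : R * R * R => x.1.2)).
    by move=> x _; rewrite mxE.
  exact: measurableT_comp.
- apply: (eq_measurable_fun (fun x : R * R * R => x.2)).
    by move=> x _; rewrite mxE.
  exact: measurable_snd.
Qed.

Lemma measurable_lin3 A : measurable_fun setT (lin3 A).
Proof.
apply: (eq_measurable_fun (fun x : R * R * R =>
  (x.1.1 * A 0 0 + x.1.2 * A 1 0 + x.2 * A 2 0,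
   x.1.1 * A 0 1 + x.1.2 * A 1 1 + x.2 * A 2 1,
   x.1.1 * A 0 2 + x.1.2 * A 1 2 + x.2 * A 2 2))).
  by move=> x _; rewrite lin3E.
have m1 : measurable_fun setT (fun x : R * R * R => x.1.1) by exact: measurableT_comp.
have m2 : measurable_fun setT (fun x : R * R * R => x.1.2) by exact: measurableT_comp.
have m3 : measurable_fun setT (fun x : R * R * R => x.2) by exact: measurable_snd.
apply/measurable_fun_pair; [apply/measurable_fun_pair|];
 do 2 ?[apply: measurable_funD];
 by apply: measurable_funM.
Qed.

Definition scales_by_det A := forall E, measurable E ->
  mu3 (lin3 A @^-1` E) = (`|\det A|^-1%:E * mu3 E)%E.

Lemma lin3M A B x : lin3 (A *m B) x = lin3 B (lin3 A x).
Proof. by rewrite /lin3 unvec3K mulmxA. Qed.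

Lemma scales_by_det_mul A B :
  scales_by_det A -> scales_by_det B -> scales_by_det (A *m B).
Proof.
move=> sA sB E mE.
have -> : lin3 (A *m B) @^-1` E = lin3 A @^-1` (lin3 B @^-1` E).
  by apply/seteqP; split => x /=; rewrite lin3M.
rewrite sA ?sB ?muleA -?EFinM ?det_mulmx ?normrM ?invfM//.
by rewrite -[X in measurable X]setTI; exact: measurable_lin3.
Qed.

(** As a map, it replaces coordinate k by the linear form u. Such maps are the
    elementary ones for which Cavalieri reduces the scaling of measures to
    dimension one. *)
Definition colmx k u : 'M[R]_3 :=
  \matrix_(i, j) (if j == k then u 0 i else (i == j)%:R).

Lemma det_colmx k u : \det (colmx k u) = u 0 k.
Proof.
rewrite (expand_det_row _ k) (bigD1 k)//= big1 ?addr0 => [|j jk]; last first.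
  by rewrite mxE (negbTE jk) eq_sym (negbTE jk) mul0r.
rewrite mxE eqxx /cofactor addnn -signr_odd odd_double mul1r.
rewrite [X in \det X](_ : _ = 1%:M) ?det1 ?mulr1//.
apply/matrixP => i j; rewrite !mxE eq_sym (negbTE (neq_lift _ _)).
by rewrite (inj_eq lift_inj).
Qed.

Lemma colmxE (k j : 'I_3) u (x : 'rV[R]_3) :
  (x *m colmx k u) 0 j = if j == k then \sum_i x 0 i * u 0 i else x 0 j.
Proof.
rewrite mxE; have [->|jk] := eqVneq j k.
  by apply: eq_bigr => i _; rewrite mxE eqxx.
rewrite (bigD1 j)//= big1 => [|i ij]; rewrite mxE (negbTE jk).
  by rewrite eqxx mulr1 addr0.
by rewrite (negbTE ij) mulr0.
Qed.

(** The constant c lets translations be treated together with linear maps. *)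
Definition affcol (k : 'I_3) u (c : R) (x : R * R * R) : R * R * R :=
  let l := x.1.1 * u 0 0 + x.1.2 * u 0 1 + x.2 * u 0 2 + c in
  (if 0 == k then l else x.1.1, if 1 == k then l else x.1.2,
   if 2 == k then l else x.2).

Lemma lin3_colmx (k : 'I_3) u : lin3 (colmx k u) = affcol k u 0.
Proof.
apply/funext => x.
by rewrite /affcol addr0 /lin3 /unvec3 3!colmxE sum_ord3 /vec3 !mxE.
Qed.

(** Freezing the two other coordinates leaves an affine map of the line of slope
    u_k; the three cases slice space in the ways that make coordinate k the
    moving one. *)
Lemma lebesgue3_affcol k u c E : u 0 k != 0 -> measurable E ->
  mu3 (affcol k u c @^-1` E) = (`|u 0 k|^-1%:E * mu3 E)%E.
Proof.
have n0 : 0 <= `|u 0 k|^-1 by rewrite invr_ge0.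
move=> u0 mE.
have mB B (e : R) : measurable B ->
    mu ((fun z => u 0 k * z + e) @^-1` B) = (`|u 0 k|^-1%:E * mu B)%E.
  exact: lebesgue_measure_affine.
pose mu2 := product_measure1_sfm mu mu.
case: (ord3P k) => kE; rewrite kE in u0 n0 mB *.
- pose tau (z : R) (s : R * R) :=
    (u 0 0 * s.1 + (s.2 * u 0 1 + z * u 0 2 + c), s.2).
  transitivity (mu3 ((fun x => (tau x.2 x.1, x.2)) @^-1` E));
    last apply: (@product_measure2_skew _ _ _ _ _ mu2 mu _ tau) => //.
  + congr (mu3 _); apply/seteqP; split => x; rewrite /affcol /tau /=;
    by rewrite [_ * u 0 0]mulrC !addrA.
  + apply: measurable_fun_pair; last exact: measurable_snd.
    apply: measurable_fun_pair; last exact: measurableT_comp.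
    do 3 ?[apply: measurable_funD] => //;
    apply: measurable_funM => //; exact: measurableT_comp.
  + move=> z B mB'; pose tau' (y : R) (x : R) :=
      u 0 0 * x + (y * u 0 1 + z * u 0 2 + c).
    apply: (@product_measure2_skew _ _ _ _ _ mu mu _ tau') => // [|y C mC].
      apply: measurable_fun_pair; last exact: measurable_snd.
      do 3 ?[apply: measurable_funD] => //;
      apply: measurable_funM => //.
    exact: mB.
- pose tau (z : R) (s : R * R) :=
    (s.1, u 0 1 * s.2 + (s.1 * u 0 0 + z * u 0 2 + c)).
  transitivity (mu3 ((fun x => (tau x.2 x.1, x.2)) @^-1` E));
    last apply: (@product_measure2_skew _ _ _ _ _ mu2 mu _ tau) => //.
  + congr (mu3 _); apply/seteqP; split => x; rewrite /affcol /tau /=;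
    by rewrite [_ * u 0 1]mulrC 2!addrA [u 0 1 * _ + _]addrC.
  + apply: measurable_fun_pair; last exact: measurable_snd.
    apply: measurable_fun_pair; first exact: measurableT_comp.
    do 3 ?[apply: measurable_funD] => //;
    apply: measurable_funM => //; exact: measurableT_comp.
  + move=> z B mB'; pose tau' (x : R) (y : R) :=
      u 0 1 * y + (x * u 0 0 + z * u 0 2 + c).
    apply: (@product_measure1_skew _ _ _ _ _ mu mu _ tau') => // x C mC.
    exact: mB.
- pose tau (s : R * R) (z : R) := u 0 2 * z + (s.1 * u 0 0 + s.2 * u 0 1 + c).
  transitivity (mu3 ((fun x => (x.1, tau x.1 x.2)) @^-1` E)); last first.
    apply: (@product_measure1_skew _ _ _ _ _ mu2 mu _ tau) => //.
    by move=> s B mB'; exact: mB.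
  congr (mu3 _); apply/seteqP; split => -[[x y] z]; rewrite /affcol /tau /=;
  by rewrite [_ * u 0 2]mulrC addrA [u 0 2 * _ + _]addrC.
Qed.

Lemma scales_by_det_col k u : u 0 k != 0 -> scales_by_det (colmx k u).
Proof. by move=> u0 E mE; rewrite lin3_colmx det_colmx lebesgue3_affcol. Qed.

Lemma measurable_affcol k u c : measurable_fun setT (affcol k u c).
Proof.
have ml : measurable_fun setT (fun x : R * R * R =>
    x.1.1 * u 0 0 + x.1.2 * u 0 1 + x.2 * u 0 2 + c).
  by do 3 ?[apply: measurable_funD] => //; apply: measurable_funM => //;
    exact: measurableT_comp.
rewrite /affcol; apply/measurable_fun_pair; [apply/measurable_fun_pair|].
- by case: (0 == k) => //; exact: measurableT_comp.
- by case: (1 == k) => //; exact: measurableT_comp.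
- case: (2 == k) => //; exact: measurable_snd.
Qed.

(** One coordinate is moved at a time. *)
Lemma lebesgue3_translate (v : 'rV[R]_3) E : measurable E ->
  mu3 ((fun x => unvec3 (v + vec3 x)) @^-1` E) = mu3 E.
Proof.
move=> mE; pose T k := affcol k (delta_mx 0 k) (v 0 k).
have tr k F : measurable F -> mu3 (T k @^-1` F) = mu3 F.
  move=> mF; rewrite lebesgue3_affcol// mxE !eqxx ?oner_neq0//.
  by rewrite normr1 invr1 mul1e.
have mT k F : measurable F -> measurable (T k @^-1` F).
  by move=> mF; rewrite -[X in measurable X]setTI; exact: measurable_affcol.
rewrite -[RHS](tr 0 _ mE) -[RHS](tr 1 _ (mT 0 _ mE)).
rewrite -[RHS](tr 2 _ (mT 1 _ (mT 0 _ mE))).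
congr (mu3 _); apply/seteqP; split => -[[x y] z] /=;
rewrite /T /affcol /unvec3 /= !mxE /=;
by rewrite !mulr0 !mulr1 ?addr0 ?add0r [x + _]addrC [y + _]addrC [z + _]addrC.
Qed.

Lemma eq_mulmx_row A B : (forall x : 'rV[R]_3, x *m A = x *m B) -> A = B.
Proof. by move=> AB; apply/row_matrixP => i; rewrite !rowE AB. Qed.

(** The exchange of x and y by additions and subtractions:
    (x, y), then (x + y, y), then (x + y, x), then (y, x). *)
Lemma tperm_mx_colmx (i j : 'I_3) : i != j ->
  tperm_mx i j = colmx i (delta_mx 0 i + delta_mx 0 j)
    *m colmx j (delta_mx 0 i - delta_mx 0 j)
    *m colmx i (delta_mx 0 i - delta_mx 0 j).
Proof.
move=> ij; have ji : j == i = false by rewrite eq_sym (negbTE ij).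
have dE (x : 'rV[R]_3) k : \sum_l x 0 l * (delta_mx 0 k : 'rV[R]_3) 0 l = x 0 k.
  rewrite (bigD1 k)//= big1 => [|l lk]; rewrite mxE eqxx ?eqxx ?mulr1 ?addr0//.
  by rewrite (negbTE lk) mulr0.
have dD (x : 'rV[R]_3) : \sum_l x 0 l * (delta_mx 0 i + delta_mx 0 j : 'rV[R]_3) 0 l
    = x 0 i + x 0 j.
  by rewrite -!dE -big_split; apply: eq_bigr => l _; rewrite [X in _ * X]mxE mulrDr.
have dB (x : 'rV[R]_3) : \sum_l x 0 l * (delta_mx 0 i - delta_mx 0 j : 'rV[R]_3) 0 l
    = x 0 i - x 0 j.
  rewrite -!dE -sumrB; apply: eq_bigr => l _.
  by rewrite [X in _ * X]mxE [(- _ : 'rV__) _ _]mxE mulrBr.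
apply: eq_mulmx_row => x; apply/rowP => k; rewrite !mulmxA.
rewrite !colmxE !dB !colmxE !dB ?dD !colmxE !dD ?eqxx ?(negbTE ij) ?ji.
rewrite -xcolE mxE; case: tpermP => [->|->|/eqP ki /eqP kj].
- by rewrite eqxx; ring.
- by rewrite eqxx ji; ring.
- by rewrite (negbTE ki) (negbTE kj).
Qed.

Lemma scales_by_det_id : scales_by_det 1%:M.
Proof.
move=> E mE; rewrite det1 normr1 invr1 mul1e; congr (mu3 _).
by apply/seteqP; split => x /=; rewrite /lin3 mulmx1 vec3K.
Qed.

Lemma scales_by_det_perm (s : 'S_3) : scales_by_det (perm_mx s).
Proof.
case: (prod_tpermP s) => ts -> /=; elim: ts => [|[i j] ts IH] /=.
  by move=> _; rewrite big_nil perm_mx1; exact: scales_by_det_id.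
move=> /andP[/= ij dts]; rewrite big_cons perm_mxM; apply: scales_by_det_mul (IH dts).
rewrite [perm_mx _]tperm_mx_colmx//;
apply: scales_by_det_mul; [apply: scales_by_det_mul|];
apply: scales_by_det_col; rewrite !mxE !eqxx ?(negbTE ij) /=
  ?[j == i]eq_sym ?(negbTE ij) /=.
- by rewrite addr0 oner_eq0.
- by rewrite sub0r oppr_eq0 oner_eq0.
- by rewrite subr0 oner_eq0.
Qed.

(** Coordinate j of the image only involves the original coordinates of index
    at least j, so the coordinates can be replaced in increasing order. *)
Lemma scales_by_det_lower A : (forall i j : 'I_3, (i < j)%N -> A i j = 0) ->
  (forall i, A i i != 0) -> scales_by_det A.
Proof.
move=> A0 Ad.
have -> : A = colmx 0 (col 0 A)^T *m colmx 1 (col 1 A)^T *m colmx 2 (col 2 A)^T.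
  apply: eq_mulmx_row => x; apply/rowP => k; rewrite !mulmxA.
  rewrite !colmxE !sum_ord3 !colmxE !sum_ord3 !colmxE !sum_ord3 !mxE sum_ord3.
  by case: (ord3P k) => ->; rewrite /= ?(A0 0 1)// ?(A0 0 2)// ?(A0 1 2)//; ring.
apply: scales_by_det_mul; [apply: scales_by_det_mul|];
  by apply: scales_by_det_col; rewrite !mxE.
Qed.

Lemma scales_by_det_upper A : (forall i j : 'I_3, (j < i)%N -> A i j = 0) ->
  (forall i, A i i != 0) -> scales_by_det A.
Proof.
move=> A0 Ad.
have -> : A = colmx 2 (col 2 A)^T *m colmx 1 (col 1 A)^T *m colmx 0 (col 0 A)^T.
  apply: eq_mulmx_row => x; apply/rowP => k; rewrite !mulmxA.
  rewrite !colmxE !sum_ord3 !colmxE !sum_ord3 !colmxE !sum_ord3 !mxE sum_ord3.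
  by case: (ord3P k) => ->; rewrite /= ?(A0 1 0)// ?(A0 2 0)// ?(A0 2 1)//; ring.
apply: scales_by_det_mul; [apply: scales_by_det_mul|];
  by apply: scales_by_det_col; rewrite !mxE.
Qed.

(** By the decomposition P A = L U, since exchanges and triangular matrices are
    products of maps replacing one coordinate. *)
Lemma scales_by_det_unit A : \det A != 0 -> scales_by_det A.
Proof.
move=> A0; case: (cormen_lup A) (@cormen_lup_correct _ _ A) (@cormen_lup_perm _ _ A)
  (@cormen_lup_lower _ _ A) (@cormen_lup_upper _ _ A) => [[P L] U] PA.
move=> /is_perm_mxP[s Ps] Ll Uu; rewrite /= in Ps Ll Uu; rewrite {}Ps in PA.
have -> : A = perm_mx s^-1 *m (L *m U).
  by rewrite -[L *m U]PA mulmxE mulrA -mulmxE -perm_mxM mulVg perm_mx1 mul1mx.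
apply: scales_by_det_mul; first exact: scales_by_det_perm.
apply: scales_by_det_mul.
  apply: scales_by_det_lower => [i j ij|i]; rewrite Ll// ?(ltnW ij)//.
    by move: ij; rewrite ltn_neqAle => /andP[/negbTE]; rewrite -val_eqE => ->.
  by rewrite eqxx oner_eq0.
apply: scales_by_det_upper => // i; apply: contra A0 => /eqP Uii.
have dU : \det U = \prod_i U i i.
  rewrite -det_tr det_trig => [|]; first by apply: eq_bigr => k _; rewrite mxE.
  by apply/is_trig_mxP => k l kl; rewrite mxE Uu.
have : \det (perm_mx s *m A) = 0.
  by rewrite mulmxE PA -mulmxE det_mulmx dU (bigD1 i)//= Uii mul0r mulr0.
by rewrite det_mulmx det_perm => /eqP; rewrite mulf_eq0 signr_eq0.
Qed.
End Linear3.

(** * Polynomials as functions on space *)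

Section PolyInd.
Variables (n : nat) (K : comNzRingType).

(** Statements on polynomial functions are proved by following the ring
    operations rather than by expanding into monomials. *)
Lemma mpoly_algebra_ind (Q : mpoly n K -> Prop) :
  (forall c, Q (mpolyC n c)) -> (forall i, Q (mpolyX K (mnm1 i))) ->
  (forall P1 P2, Q P1 -> Q P2 -> Q (P1 + P2)) ->
  (forall P1 P2, Q P1 -> Q P2 -> Q (P1 * P2)) -> forall P, Q P.
Proof.
move=> QC QX QD QM P.
have Qp P' j : Q P' -> Q (P' ^+ j).
  move=> QP; elim: j => [|j IH]; first by rewrite expr0; exact: (QC 1).
  by rewrite exprS; exact: QM.
rewrite (mpolyE P); apply: big_ind; [|exact: QD|].
  have -> : 0 = mpolyC n (0 : K) by rewrite mpolyC0.
  exact: QC.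
move=> m _; rewrite -mul_mpolyC; apply: (QM) => //.
rewrite mpolyXE_id; apply: big_ind; [exact: (QC 1)|exact: QM|].
by move=> i _; exact: Qp.
Qed.
End PolyInd.

HB.lock Definition peval (R : realType) (P : mpoly 3 R[i]) (x : 'rV[R]_3) : R[i] :=
  meval (cvec x 0) P.

(** On real points this is the conjugate of the polynomial function, which
    makes the integrand of an inner product again a polynomial. *)
HB.lock Definition pconj (R : realType) (P : mpoly 3 R[i]) : mpoly 3 R[i] :=
  map_mpoly (@conjc R) P.

HB.lock Definition pdir (R : realType) (b : 'rV[R]_3) (P : mpoly 3 R[i]) :
  mpoly 3 R[i] := \sum_k (b 0 k)%:C *: mderiv k P.

Section PolyFunctions.
Variable R : realType.
Local Notation C := R[i].
Local Notation pol := (mpoly 3 C).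
Implicit Types P Q : pol.

Lemma pevalE P x : peval P x = meval (cvec x 0) P.
Proof. by rewrite peval.unlock. Qed.

Lemma pevalC (c : C) x : peval (mpolyC 3 c) x = c.
Proof. by rewrite pevalE; exact: mevalC. Qed.

Lemma pevalX i x : peval (mpolyX C (mnm1 i)) x = (x 0 i)%:C.
Proof. by rewrite pevalE mevalXU mxE. Qed.

Lemma pevalD P Q x : peval (P + Q) x = peval P x + peval Q x.
Proof. by rewrite !pevalE; exact: mevalD. Qed.

Lemma pevalM P Q x : peval (P * Q) x = peval P x * peval Q x.
Proof. by rewrite !pevalE; exact: mevalM. Qed.

Lemma pevalZ c P x : peval (c *: P) x = c * peval P x.
Proof. by rewrite !pevalE; exact: mevalZ. Qed.

Lemma pconjE P : pconj P = map_mpoly (@conjc R) P.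
Proof. by rewrite pconj.unlock. Qed.

Lemma pconjC (c : C) : pconj (mpolyC 3 c) = mpolyC 3 (c^*)%C.
Proof. by rewrite !pconjE map_mpolyC. Qed.

Lemma pconjX i : pconj (mpolyX C (mnm1 i)) = mpolyX C (mnm1 i) :> pol.
Proof. by rewrite !pconjE map_mpolyX. Qed.

Lemma pconjD P Q : pconj (P + Q) = pconj P + pconj Q.
Proof. rewrite !pconjE; exact: raddfD. Qed.

Lemma pconjM P Q : pconj (P * Q) = pconj P * pconj Q.
Proof. rewrite !pconjE; exact: rmorphM. Qed.

Lemma peval_conj P x : peval (pconj P) x = (peval P x)^*.
Proof.
elim/mpoly_algebra_ind: P => [c|i|P Q IP IQ|P Q IP IQ].
- by rewrite pconjC !pevalC.
- by rewrite pconjX !pevalX conjc_real.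
- rewrite pconjD !pevalD IP IQ; exact/esym/(raddfD (@conjc R)).
- rewrite pconjM !pevalM IP IQ; exact/esym/(rmorphM (@conjc R)).
Qed.

Lemma Re_mul (a b : C) : complex.Re (a * b) =
  complex.Re a * complex.Re b - complex.Im a * complex.Im b.
Proof. by case: a b => [? ?] [? ?]. Qed.

Lemma Im_mul (a b : C) : complex.Im (a * b) =
  complex.Re a * complex.Im b + complex.Im a * complex.Re b.
Proof. by case: a b => [? ?] [? ?]. Qed.

Lemma Re_add (a b : C) : complex.Re (a + b) = complex.Re a + complex.Re b.
Proof. by case: a b => [? ?] [? ?]. Qed.

Lemma Im_add (a b : C) : complex.Im (a + b) = complex.Im a + complex.Im b.
Proof. by case: a b => [? ?] [? ?]. Qed.

Lemma complexext (a b : C) : complex.Re a = complex.Re b ->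
  complex.Im a = complex.Im b -> a = b.
Proof. by case: a b => [? ?] [? ?] /= -> ->. Qed.

Lemma measurable_peval d (T : measurableType d) (xi : T -> 'rV[R]_3) P :
  (forall k, measurable_fun setT (fun t => xi t 0 k)) ->
  measurable_fun setT (fun t => complex.Re (peval P (xi t))) /\
  measurable_fun setT (fun t => complex.Im (peval P (xi t))).
Proof.
move=> mxi; elim/mpoly_algebra_ind: P => [c|i|P Q [IP JP] [IQ JQ]|P Q [IP JP] [IQ JQ]].
- by split; under eq_fun do rewrite pevalC; exact: measurable_cst.
- by split; under eq_fun do rewrite pevalX /=; [exact: mxi|exact: measurable_cst].
- by split; under eq_fun do rewrite pevalD ?Re_add ?Im_add;
    exact: measurable_funD.
- split; under eq_fun do rewrite pevalM ?Re_mul ?Im_mul.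
    by apply: measurable_funB; exact: measurable_funM.
  by apply: measurable_funD; exact: measurable_funM.
Qed.

Lemma bounded_peval M P : exists B, forall x : 'rV[R]_3,
  (forall k, `|x 0 k| <= M) ->
  `|complex.Re (peval P x)| <= B /\ `|complex.Im (peval P x)| <= B.
Proof.
elim/mpoly_algebra_ind: P => [c|i|P Q [A IA] [B IB]|P Q [A IA] [B IB]].
- exists (`|complex.Re c| + `|complex.Im c|) => x _; rewrite pevalC.
  by rewrite lerDl lerDr.
- exists `|M| => x xM; rewrite pevalX /= normr0; split => //.
  exact: le_trans (xM i) (ler_norm _).
- exists (A + B) => x xM; have [A1 A2] := IA x xM; have [B1 B2] := IB x xM.
  by rewrite pevalD Re_add Im_add; split; apply: le_trans (ler_normD _ _) _; exact: lerD.
- exists (A * B + A * B) => x xM.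
  have [A1 A2] := IA x xM; have [B1 B2] := IB x xM.
  rewrite pevalM Re_mul Im_mul; split; [apply: le_trans (ler_normB _ _) _|
    apply: le_trans (ler_normD _ _) _]; by apply: lerD; rewrite normrM; apply: ler_pM.
Qed.

Lemma continuous_peval (T : topologicalType) (xi : T -> 'rV[R]_3) P :
  (forall k, continuous (fun t => xi t 0 k : R)) ->
  continuous (fun t => complex.Re (peval P (xi t))) /\
  continuous (fun t => complex.Im (peval P (xi t))).
Proof.
move=> cxi; elim/mpoly_algebra_ind: P => [c|i|P Q [IP JP] [IQ JQ]|P Q [IP JP] [IQ JQ]].
- by split; under eq_fun do rewrite pevalC; exact: cst_continuous.
- by split; under eq_fun do rewrite pevalX /=; [exact: cxi|exact: cst_continuous].
- by split; under eq_fun do rewrite pevalD ?Re_add ?Im_add; move=> t;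
    [apply: (cvgD (IP t) (IQ t))|apply: (cvgD (JP t) (JQ t))].
- split; under eq_fun do rewrite pevalM ?Re_mul ?Im_mul; move=> t.
    exact: (cvgB (cvgM (IP t) (IQ t)) (cvgM (JP t) (JQ t))).
  exact: (cvgD (cvgM (IP t) (JQ t)) (cvgM (JP t) (IQ t))).
Qed.

Section DeriveFun.
Variables (f g : R -> R) (t df dg : R).
Hypotheses (Df : is_derive t 1 f df) (Dg : is_derive t 1 g dg).

Lemma is_derive_fun_add : is_derive t 1 (fun s => f s + g s) (df + dg).
Proof. exact: (is_deriveD Df Dg). Qed.

Lemma is_derive_fun_sub : is_derive t 1 (fun s => f s - g s) (df - dg).
Proof. exact: (is_deriveB Df Dg). Qed.

Lemma is_derive_fun_mul :
  is_derive t 1 (fun s => f s * g s) (df * g t + f t * dg).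
Proof.
apply: (is_derive_eq (is_deriveM Df Dg)).
by rewrite /GRing.scale /= addrC [g t * _]mulrC.
Qed.
End DeriveFun.

Lemma pdirE (b : 'rV[R]_3) P : pdir b P = \sum_k (b 0 k)%:C *: mderiv k P.
Proof. by rewrite pdir.unlock. Qed.

Lemma is_derive_peval (x b : 'rV[R]_3) P (t : R) :
  is_derive t 1 (fun t => complex.Re (peval P (x + t *: b)))
    (complex.Re (peval (pdir b P) (x + t *: b))) /\
  is_derive t 1 (fun t => complex.Im (peval P (x + t *: b)))
    (complex.Im (peval (pdir b P) (x + t *: b))).
Proof.
have pdirM P' Q' : pdir b (P' * Q') = pdir b P' * Q' + P' * pdir b Q'.
  rewrite !pdirE mulr_suml mulr_sumr -big_split; apply: eq_bigr => k _ /=.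
  by rewrite mderivM scalerDr scalerAl scalerAr.
have pdirD P' Q' : pdir b (P' + Q') = pdir b P' + pdir b Q'.
  rewrite !pdirE -big_split; apply: eq_bigr => k _ /=.
  by rewrite mderivD scalerDr.
elim/mpoly_algebra_ind: P => [c|i|P Q [IP JP] [IQ JQ]|P Q [IP JP] [IQ JQ]].
- have -> : pdir b (mpolyC 3 c) = mpolyC 3 0.
    by rewrite pdirE big1 ?mpolyC0// => k _; rewrite mderivC scaler0.
  by split; under eq_fun do rewrite pevalC; rewrite pevalC; exact: is_derive_cst.
- have -> : pdir b (mpolyX C (mnm1 i)) = mpolyC 3 (b 0 i)%:C.
    rewrite pdirE (bigD1 i)//= big1 ?addr0 => [|k ki]; rewrite mderivX mnm1E.
      rewrite eqxx scale1r (_ : mnm_sub _ _ = mnm0) ?mpolyX0.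
        by rewrite -mul_mpolyC mulr1.
      by apply/mnmP => l; rewrite mnmBE mnm0E subnn.
    by rewrite eq_sym (negbTE ki) scale0r scaler0.
  rewrite pevalC; split; under eq_fun do rewrite pevalX !mxE /=.
    apply: (is_derive_eq (is_derive_fun_add (is_derive_cst (x 0 i) t 1)
      (is_derive_fun_mul (is_derive_id t 1) (is_derive_cst (b 0 i) t 1)))).
    by rewrite mulr0 addr0 mul1r add0r.
  exact: is_derive_cst.
- by split; under eq_fun do rewrite pevalD ?Re_add ?Im_add;
   rewrite pdirD pevalD ?Re_add ?Im_add;
   exact: is_derive_fun_add.
- split; under eq_fun do rewrite pevalM ?Re_mul ?Im_mul;
    rewrite pdirM pevalD ?Re_add ?Im_add !pevalM ?Re_mul ?Im_mul.
    apply: (is_derive_eq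
      (is_derive_fun_sub (is_derive_fun_mul IP IQ) (is_derive_fun_mul JP JQ))).
    by ring.
  apply: (is_derive_eq
    (is_derive_fun_add (is_derive_fun_mul IP JQ) (is_derive_fun_mul JP IQ))).
  by ring.
Qed.

End PolyFunctions.

Section PolyDerivatives.
Variable n : nat.
Variable K : numDomainType.
Implicit Types P : mpoly n K.

Lemma msize_mderiv k P s : (msize P <= s.+1)%N -> (msize (mderiv k P) <= s)%N.
Proof.
move=> Ps; rewrite msizeE big_seq; elim/big_ind: _ => // [x y xs ys|m].
  by rewrite geq_max xs.
rewrite mcoeff_msupp mcoeff_mderiv => H.
have mP : mnm_add m (mnm1 k) \in msupp P.
  by rewrite mcoeff_msupp; apply: contra H => /eqP ->; rewrite mul0rn.
have := leq_trans (msize_mdeg_lt mP) Ps.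
by rewrite mdegD mdeg1 addn1 ltnS.
Qed.

(** The coefficient of a nonconstant monomial m reappears, multiplied by a
    positive integer, in the derivative with respect to a variable of m. *)
Lemma mderiv_eq0_const P :
  (forall k, mderiv k P = 0) -> P = mpolyC n (mcoeff (@mnm0 n) P).
Proof.
move=> dP; apply/mpolyP => m; rewrite mcoeffC.
have [->|m0] := eqVneq m (@mnm0 n); first by rewrite mulr1.
rewrite mulr0; have [k mk] : exists k, (0 < m k)%N.
  apply/existsP; apply: contraR m0; rewrite negb_exists => /forallP m0.
  by apply/eqP/mnmP => k; rewrite mnm0E; apply/eqP; rewrite -leqn0 leqNgt m0.
have := congr1 (mcoeff (mnm_sub m (mnm1 k))) (dP k).
rewrite mcoeff_mderiv mcoeff0 submK => [/eqP|]; last first.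
  apply/mnm_lepP => l; rewrite mnm1E; case: eqP => // <-; exact: mk.
by rewrite mulrn_eq0 => /orP[//|/eqP].
Qed.
End PolyDerivatives.

(** * Polynomials vanishing on an open set *)

Section ZeroOnOpen.
Variable R : realType.
Local Notation C := R[i].

Lemma pdir_delta k (P : mpoly 3 C) : pdir (delta_mx 0 k) P = mderiv k P.
Proof.
rewrite pdirE (bigD1 k)//= big1 => [|l lk]; rewrite !mxE eqxx ?eqxx.
  by rewrite scale1r addr0.
by rewrite (negbTE lk) scale0r.
Qed.

Lemma is_derive_near0 (f : R -> R) (t df : R) : is_derive t 1 f df ->
  (\forall s \near t, f s = 0) -> df = 0.
Proof.
move=> Df f0; have := @derive_val _ _ _ _ _ _ _ Df => <-.
by rewrite (@near_eq_derive _ _ _ f (cst 0) t 1 f0) derive_cst.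
Qed.

(** The derivatives vanish on U too, because U contains a piece of every line
    through each of its points; by induction on the degree they are zero
    polynomials, so P is a constant, and it vanishes at x0. *)
Lemma peval0_eq0 (U : set 'rV[R]_3) (x0 : 'rV[R]_3) (P : mpoly 3 C) : U x0 ->
  (forall x b : 'rV[R]_3, U x -> \forall s \near (0 : R), U (x + s *: b)) ->
  (forall x, U x -> peval P x = 0) -> P = 0.
Proof.
move=> Ux0 oU; have [s] := ubnP (msize P); elim: s P => // s IH P Ps P0.
have dP k : mderiv k P = 0.
  case: s IH Ps => [|s] IH Ps.
    by move: Ps; rewrite ltnS leqn0 msize_poly_eq0 => /eqP ->; rewrite mderiv0.
  apply: IH => [|x Ux]; first by rewrite ltnS; apply: msize_mderiv.
  have [DR DI] := is_derive_peval x (delta_mx 0 k) P 0.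
  rewrite pdir_delta scale0r addr0 in DR DI.
  by apply: complexext; [apply: (is_derive_near0 DR)|apply: (is_derive_near0 DI)];
    near=> t; rewrite P0//; near: t; exact: oU.
rewrite (mderiv_eq0_const dP) in P0 *.
by have := P0 x0 Ux0; rewrite pevalC => ->; rewrite mpolyC0.
Unshelve. all: by end_near.
Qed.
End ZeroOnOpen.

(** * Integrals of polynomials *)

Section ComplexIntegral.
Variables (R : realType) (d : measure_display) (T : measurableType d).
Variables (m : {measure set T -> \bar R}) (D : set T) (xi : T -> 'rV[R]_3).
Hypothesis mD : measurable D.
Hypothesis finD : (m D < +oo)%E.
Hypothesis mxi : forall k, measurable_fun setT (fun t => xi t 0 k).
Hypothesis bxi : exists M, forall t, D t -> forall k, `|xi t 0 k| <= M.
Local Notation C := R[i].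
Implicit Types P Q : mpoly 3 C.

Lemma integrable_peval P :
  m.-integrable D (EFin \o (fun t => complex.Re (peval P (xi t)))) /\
  m.-integrable D (EFin \o (fun t => complex.Im (peval P (xi t)))).
Proof.
have [mR mI] := measurable_peval P mxi.
have [M bM] := bxi; have [B bB] := bounded_peval M P.
split; apply: measurable_bounded_integrable => //; try exact: measurable_funTS;
exists B; split; rewrite ?num_real// => z Bz t Dt;
have [B1 B2] := bB (xi t) (bM t Dt); apply: le_trans (ltW Bz) => //.
Qed.

(** The integrals over the tetrahedron and over its parametrized faces are both
    of this kind. *)
Definition pull_int P : C := Cintegral m D (fun t => peval P (xi t)).

Lemma pull_int_add P Q : pull_int (P + Q) = pull_int P + pull_int Q.
Proof.
have [[RP IP] [RQ IQ]] := (integrable_peval P, integrable_peval Q).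
apply: complexext; rewrite /= -RintegralD//; apply: eq_Rintegral => t _ /=;
by rewrite pevalD ?Re_add ?Im_add.
Qed.

Lemma pull_int_scale c P : pull_int (c *: P) = c * pull_int P.
Proof.
have [RP IP] := integrable_peval P.
have iZ f r : m.-integrable D (EFin \o f) -> m.-integrable D (EFin \o (fun t => r * f t)).
  move=> fi; have := integrableZl mD r fi; apply: eq_integrable => //.
apply: complexext; [rewrite [RHS]Re_mul|rewrite [RHS]Im_mul];
  rewrite /pull_int /Cintegral /= -!RintegralZl//.
- by rewrite -RintegralB//;
    [apply: eq_Rintegral => t _; rewrite pevalZ Re_mul|exact: iZ..].
- by rewrite -RintegralD//;
    [apply: eq_Rintegral => t _; rewrite pevalZ Im_mul|exact: iZ..].
Qed.

Lemma pull_int_conj P : pull_int (pconj P) = (pull_int P)^*.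
Proof.
have [RP IP] := integrable_peval P.
rewrite /pull_int /Cintegral; apply: complexext => /=.
  by apply: eq_Rintegral => t _; rewrite peval_conj; case: (peval _ _).
rewrite -mulN1r -RintegralZl//; apply: eq_Rintegral => t _; rewrite peval_conj mulN1r.
by case: (peval _ _).
Qed.

(** On real points P times its conjugate is a squared modulus. *)
Lemma pull_int_ge0 P : 0 <= pull_int (P * pconj P).
Proof.
rewrite lecE /pull_int /=; apply/andP; split.
  rewrite /Rintegral integral0_eq// => t _; rewrite pevalM peval_conj.
  by case: (peval P _) => u v /=; congr (_%:E); ring.
apply: Rintegral_ge0 => t _; rewrite pevalM peval_conj.
by case: (peval P _) => u v /=; rewrite mulrN opprK addr_ge0// -expr2 sqr_ge0.
Qed.

End ComplexIntegral.

(** * Barycentric coordinates *)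

Section Barycentric.
Variables (R : realType) (a : 'I_4 -> 'rV[R]_3).
Hypothesis nd : tetra_nondegenerate a.
Local Notation C := R[i].
Implicit Types (w : 'I_4 -> R) (x b : 'rV[R]_3).

Definition edgemx : 'M[R]_3 := \matrix_(j < 3) (a (lift ord0 j) - a ord0).

Lemma edgemx_unit : edgemx \in unitmx.
Proof. by rewrite unitmxE unitfE. Qed.

(** A combination of the vertices is a point plus a combination of the edges
    issued from the first vertex, which form a basis. *)
Lemma weighted_vertices w : \sum_j w j *: a j =
  (\sum_j w j) *: a ord0 + (\row_(j < 3) w (lift ord0 j)) *m edgemx.
Proof.
rewrite mulmx_sum_row (bigD1_ord ord0)//= [\sum_(j < 4) w j](bigD1_ord ord0)//=.
rewrite scalerDl -addrA; congr (_ + _).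
rewrite scaler_suml -big_split; apply: eq_bigr => j _ /=.
by rewrite rowK mxE scalerBr subrKC.
Qed.

Definition bary x (j : 'I_4) : R :=
  if unlift ord0 j is Some k then ((x - a ord0) *m invmx edgemx) 0 k
  else 1 - \sum_k ((x - a ord0) *m invmx edgemx) 0 k.

Lemma bary_sum x : \sum_j bary x j = 1.
Proof.
rewrite (bigD1_ord ord0)//= /bary unlift_none; under eq_bigr do rewrite liftK.
by rewrite subrK.
Qed.

Lemma bary_combination x : \sum_j bary x j *: a j = x.
Proof.
rewrite weighted_vertices bary_sum scale1r.
rewrite (_ : \row_j _ = (x - a ord0) *m invmx edgemx).
  by rewrite -mulmxA mulVmx ?edgemx_unit// mulmx1 subrKC.
by apply/rowP => k; rewrite mxE /bary liftK.
Qed.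

Lemma bary_unique w x : \sum_j w j = 1 -> \sum_j w j *: a j = x -> w =1 bary x.
Proof.
move=> w1; rewrite weighted_vertices w1 scale1r => wx.
have wE : \row_j w (lift ord0 j) = (x - a ord0) *m invmx edgemx.
  by rewrite -wx addrAC subrr add0r -mulmxA mulmxV ?edgemx_unit// mulmx1.
have wl k : w (lift ord0 k) = ((x - a ord0) *m invmx edgemx) 0 k.
  by rewrite -wE mxE.
move=> j; rewrite /bary; case: unliftP => [k ->|->]; first exact: wl.
rewrite -w1 (bigD1_ord ord0)//=.
by rewrite (eq_bigr _ (fun k _ => wl k)) addrK.
Qed.

Lemma tetrahedronP x : tetrahedron a x <-> forall j, 0 <= bary x j.
Proof.
split=> [[w [w0 w1 xw]] j|b0]; first by rewrite -(bary_unique w1 (esym xw)).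
by exists (bary x); rewrite bary_sum bary_combination.
Qed.

(** Barycentric coordinates as polynomials, so that they inherit the continuity
    and the measurability of polynomial functions. *)
Definition baryp (j : 'I_4) : mpoly 3 C :=
  let coord (k : 'I_3) := \sum_l (invmx edgemx l k)%:C *:
    (mpolyX C (mnm1 l) - mpolyC 3 (a ord0 0 l)%:C) in
  if unlift ord0 j is Some k then coord k else mpolyC 3 1 - \sum_k coord k.

Lemma pevalN P x : peval (- P) x = - peval P x.
Proof. by rewrite !pevalE; exact: mevalN. Qed.

Lemma pevalB P Q x : peval (P - Q) x = peval P x - peval Q x.
Proof. by rewrite pevalD pevalN. Qed.

Lemma peval_sum (I : finType) (F : I -> mpoly 3 C) x :
  peval (\sum_i F i) x = \sum_i peval (F i) x.
Proof. by rewrite pevalE raddf_sum; apply: eq_bigr => i _; rewrite pevalE. Qed.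

Lemma peval_baryp j x : peval (baryp j) x = (bary x j)%:C.
Proof.
have coord k : peval (\sum_l (invmx edgemx l k)%:C *:
    (mpolyX C (mnm1 l) - mpolyC 3 (a ord0 0 l)%:C)) x =
    (((x - a ord0) *m invmx edgemx) 0 k)%:C.
  rewrite peval_sum mxE rmorph_sum; apply: eq_bigr => l _ /=.
  by rewrite pevalZ pevalB pevalX pevalC !mxE -rmorphB /= -rmorphM mulrC.
rewrite /baryp /bary; case: unliftP => [k _|_]; first exact: coord.
rewrite pevalB pevalC peval_sum rmorphB rmorph1 rmorph_sum; congr (_ - _).
by apply: eq_bigr => k _; rewrite coord.
Qed.

Lemma continuous_bary (T : topologicalType) (xi : T -> 'rV[R]_3) j :
  (forall k, continuous (fun t => xi t 0 k : R)) ->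
  continuous (fun t => bary (xi t) j).
Proof.
move=> cxi; have [+ _] := continuous_peval (baryp j) cxi.
by under eq_fun do rewrite peval_baryp.
Qed.

Lemma measurable_bary d (T : measurableType d) (xi : T -> 'rV[R]_3) j :
  (forall k, measurable_fun setT (fun t => xi t 0 k)) ->
  measurable_fun setT (fun t => bary (xi t) j).
Proof.
move=> mxi; have [+ _] := measurable_peval (baryp j) mxi.
by under eq_fun do rewrite peval_baryp.
Qed.

Lemma measurable_tetrahedron d (T : measurableType d) (xi : T -> 'rV[R]_3) :
  (forall k, measurable_fun setT (fun t => xi t 0 k)) ->
  measurable (xi @^-1` tetrahedron a).
Proof.
move=> mxi.
have -> : xi @^-1` tetrahedron a =
    \bigcap_(j in [set: 'I_4]) ((fun t => bary (xi t) j) @^-1` `[0, +oo[%classic).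
  apply/seteqP; split => t /=.
    by move/tetrahedronP => b0 j _ /=; rewrite in_itv/= b0.
  move=> b0; apply/tetrahedronP => j; have := b0 j I.
  by rewrite /= in_itv/= andbT.
apply: fin_bigcap_measurable => // j _.
rewrite -[X in measurable X]setTI.
by apply: (measurable_bary j mxi).
Qed.

Lemma bounded_tetrahedron : exists M : R,
  forall x, tetrahedron a x -> forall k, `|x 0 k| <= M.
Proof.
exists (\sum_j \sum_k `|a j 0 k|) => x [w [w0 w1 ->]] k.
rewrite summxE; apply: le_trans (ler_norm_sum _ _ _) _; apply: ler_sum => j _.
rewrite mxE normrM ger0_norm//.
have wj : w j <= 1 by rewrite -w1 (bigD1 j)//= lerDl sumr_ge0.
apply: le_trans (ler_wpM2r _ wj) _ => //; rewrite mul1r.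
by rewrite (bigD1 k)//= lerDl sumr_ge0.
Qed.
End Barycentric.

(** * Integration over the tetrahedron *)

Section VolumeFunctional.
Variables (R : realType) (a : 'I_4 -> 'rV[R]_3).
Hypothesis nd : tetra_nondegenerate a.
Local Notation C := R[i].
Local Notation mu := (@lebesgue_measure R).
Local Notation mu3 := (mu \x mu \x mu)%E.
Implicit Types P Q : mpoly 3 C.

Local Notation D := (@vec3 R @^-1` tetrahedron a).

Lemma lebesgue3_box (r x y z : R) : 0 <= r ->
  mu3 (ball x r `*` ball y r `*` ball z r) = ((r *+ 2) ^+ 3)%:E.
Proof.
move=> r0.
transitivity ((mu \x mu) (ball x r `*` ball y r) * mu (ball z r))%E.
  apply: product_measure1E; last exact: measurable_ball.
  by apply: measurableX; exact: measurable_ball.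
transitivity (mu (ball x r) * mu (ball y r) * mu (ball z r))%E.
  by congr (_ * _)%E; apply: product_measure1E; exact: measurable_ball.
by rewrite !lebesgue_measure_ball// -!EFinM -expr2 -exprSr.
Qed.

Lemma measurable_tetra : measurable D.
Proof. exact: (measurable_tetrahedron nd (@measurable_vec3 R)). Qed.

Lemma finite_tetra : (mu3 D < +oo)%E.
Proof.
have [M bM] := bounded_tetrahedron a.
have M0 : 0 <= M.
  apply: le_trans (bM (a ord0) _ 0); first exact: normr_ge0.
  exists (fun j => (j == ord0)%:R); split.
  - by move=> j; exact: ler0n.
  - by rewrite (bigD1 ord0)//= big1 ?addr0// => j /negbTE ->.
  - by rewrite (bigD1 ord0)//= big1 ?addr0 ?scale1r// => j /negbTE ->; rewrite scale0r.
(* the balls are open, hence the margin 1 *)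
have M1 : 0 <= M + 1 by rewrite addr_ge0.
apply: (@le_lt_trans _ _ (mu3
  (ball (0:R) (M+1) `*` ball (0:R) (M+1) `*` ball (0:R) (M+1)))).
  apply: le_measure; rewrite ?inE.
  - exact: measurable_tetra.
  - by apply: measurableX; [apply: measurableX|]; exact: measurable_ball.
  - move=> [[x y] z] /= /bM bx.
    have := bx 0; have := bx 1; have := bx 2; rewrite !mxE /= => z1 y1 x1.
    by split; [split|]; rewrite /= /ball /= sub0r normrN;
       (apply: le_lt_trans; first by [exact: x1|exact: y1|exact: z1]); rewrite ltrDl.
by rewrite lebesgue3_box// ltry.
Qed.
End VolumeFunctional.

Lemma continuous_line (R : realType) (x b : 'rV[R]_3) k :
  continuous (fun s : R => (x + s *: b) 0 k : R).
Proof.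
move=> s; under eq_fun do rewrite !mxE.
exact: (cvgD (cvg_cst (x 0 k)) (cvgM (@cvg_id _ (nbhs s)) (cvg_cst (b 0 k)))).
Qed.

Section VolumeDefinite.
Variables (R : realType) (a : 'I_4 -> 'rV[R]_3).
Hypothesis nd : tetra_nondegenerate a.
Local Notation C := R[i].
Local Notation mu := (@lebesgue_measure R).
Local Notation mu3 := (mu \x mu \x mu)%E.
Implicit Types P Q : mpoly 3 C.
Local Notation D := (@vec3 R @^-1` tetrahedron a).

Definition vol_int P : C := pull_int mu3 D (@vec3 R) P.

Lemma bounded_vec3 : exists M : R, forall t, D t -> forall k, `|vec3 t 0 k| <= M.
Proof. by have [M bM] := bounded_tetrahedron a; exists M => t /bM. Qed.

Let mD := measurable_tetra nd.
Let fD := finite_tetra nd.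
Let mv := @measurable_vec3 R.

Lemma integrable_vol_int P :
  mu3.-integrable D (EFin \o (fun t => complex.Re (peval P (vec3 t)))) /\
  mu3.-integrable D (EFin \o (fun t => complex.Im (peval P (vec3 t)))).
Proof.
by apply: integrable_peval; [exact: mD|exact: fD|exact: mv|exact: bounded_vec3].
Qed.

Lemma vol_int_add P Q : vol_int (P + Q) = vol_int P + vol_int Q.
Proof. by apply: pull_int_add; [exact: mD|exact: fD|exact: mv|exact: bounded_vec3]. Qed.

Lemma vol_int_scale c P : vol_int (c *: P) = c * vol_int P.
Proof. by apply: pull_int_scale; [exact: mD|exact: fD|exact: mv|exact: bounded_vec3]. Qed.

Lemma vol_int0 : vol_int 0 = 0.
Proof. by rewrite -[X in vol_int X](scale0r (0 : mpoly 3 C)) vol_int_scale mul0r. Qed.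

Lemma vol_int_sum (I : finType) (F : I -> mpoly 3 C) :
  vol_int (\sum_i F i) = \sum_i vol_int (F i).
Proof. exact: (big_morph vol_int vol_int_add vol_int0). Qed.

Lemma vol_int_conj P : vol_int (pconj P) = (vol_int P)^*.
Proof. by apply: pull_int_conj; [exact: mD|exact: fD|exact: mv|exact: bounded_vec3]. Qed.

Lemma vol_int_ge0 P : 0 <= vol_int (P * pconj P).
Proof. exact: pull_int_ge0. Qed.

Lemma continuous_vec3 k : continuous (fun t : R * R * R => vec3 t 0 k : R).
Proof.
move=> [[x y] z]; case: (ord3P k) => ->; rewrite /vec3 /=.
- apply: (@cvg_trans _ ((fun t : R * R * R => t.1.1) @ (x, y, z))).
    by apply: near_eq_cvg; near=> t; rewrite mxE.
  rewrite mxE /=; apply: (@continuous_comp _ _ _ fst fst (x, y, z)); exact: cvg_fst.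
- apply: (@cvg_trans _ ((fun t : R * R * R => t.1.2) @ (x, y, z))).
    by apply: near_eq_cvg; near=> t; rewrite mxE.
  rewrite mxE /=; apply: (@continuous_comp _ _ _ fst snd (x, y, z)).
    exact: cvg_fst.
  exact: cvg_snd.
- apply: (@cvg_trans _ ((fun t : R * R * R => t.2) @ (x, y, z))).
    by apply: near_eq_cvg; near=> t; rewrite mxE.
  rewrite mxE /=; exact: cvg_snd.
Unshelve. all: by end_near.
Qed.

Let U := [set x : 'rV[R]_3 | forall j, 0 < bary a x j].

Lemma near_interior (T : topologicalType) (xi : T -> 'rV[R]_3) t :
  (forall k, continuous (fun t => xi t 0 k : R)) -> U (xi t) ->
  \forall s \near t, U (xi s).
Proof.
move=> cxi Ut; apply: filter_forall => j.
exact: (cvgr_gt _ (@continuous_bary _ a _ _ j cxi t) _ (Ut j)).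
Qed.

(** If P did not vanish at some interior point, then its squared modulus would
    stay above a positive constant on a small box inside the tetrahedron, and
    the integral would be positive. So P vanishes on the interior. *)
Lemma vol_int_eq0 P : vol_int (P * pconj P) = 0 -> P = 0.
Proof.
move=> vP0.
(* the barycenter is interior *)
have Ux0 : U (\sum_j 4^-1 *: a j).
  move=> j; rewrite -(@bary_unique _ _ nd (fun _ => 4^-1) _ _ erefl) ?invr_gt0//.
  by rewrite sumr_const card_ord -[RHS](@mulVf _ (4 : R))// mulr_natr.
apply: (peval0_eq0 Ux0) => [x b Ux|x Ux].
  apply: (@near_interior R^o (fun s => x + s *: b) 0).
    exact: continuous_line.
  by rewrite scale0r addr0.
apply/eqP/negPn/negP => Px0.
pose f t := complex.Re (peval (P * pconj P) (vec3 t)).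
have fE t : f t = complex.Re (peval P (vec3 t)) ^+ 2 + complex.Im (peval P (vec3 t)) ^+ 2.
  rewrite /f pevalM peval_conj; case: (peval P _) => u v /=.
  by rewrite mulrN opprK !expr2.
have f_ge0 t : 0 <= f t by rewrite fE addr_ge0 ?sqr_ge0.
have f_gt0 : 0 < f (unvec3 x).
  rewrite lt_neqAle f_ge0 andbT eq_sym fE unvec3K; apply: contra Px0.
  by rewrite paddr_eq0 ?sqr_ge0// !sqrf_eq0 eq_complex.
have [cf _] := continuous_peval (P * pconj P) continuous_vec3.
have : \forall t \near unvec3 x, f (unvec3 x) / 2 < f t /\ U (vec3 t).
  near=> t; split; near: t; last first.
    by apply: near_interior continuous_vec3 _; rewrite unvec3K.
  by apply: (cvgr_gt _ (cf (unvec3 x))); rewrite ltr_pdivrMr// ltr_pMr// ltr1n.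
move=> /nbhs_ballP[r /= r0 rU].
pose B : set (R * R * R) :=
  ball (unvec3 x).1.1 r `*` ball (unvec3 x).1.2 r `*` ball (unvec3 x).2 r.
have BU (t : R * R * R) : B t -> f (unvec3 x) / 2 < f t /\ U (vec3 t).
  by move=> [[t1 t2] t3]; exact: rU.
have BD : B `<=` D.
  by move=> t Bt; have [_ Ut] := BU t Bt; apply/(tetrahedronP nd) => j; exact/ltW/Ut.
have mB : measurable B.
  by apply: measurableX; [apply: measurableX|]; exact: measurable_ball.
have [mf _] := measurable_peval (P * pconj P) mv.
have fi : (\int[mu3]_(t in D) (f t)%:E = 0)%E.
  have [fi _] := integrable_vol_int (P * pconj P).
  have := congr1 (@complex.Re R) vP0; rewrite /vol_int /pull_int /Cintegral /= => fR.
  by rewrite -[LHS]fineK ?[fine _]fR//; exact: integrable_fin_num fi.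
have : (\int[mu3]_(t in B) (f (unvec3 x) / 2)%:E <= \int[mu3]_(t in D) (f t)%:E)%E.
  apply: (@le_trans _ _ (\int[mu3]_(t in B) (f t)%:E)%E).
    apply: ge0_le_integral => //.
    - by move=> t _; rewrite lee_fin divr_ge0.
    - exact/measurable_EFinP/measurable_funTS.
    - by move=> t Bt; have [ft _] := BU t Bt; rewrite lee_fin ltW.
  apply: ge0_subset_integral => //.
  - exact/measurable_EFinP/measurable_funTS.
  - by move=> t _; rewrite lee_fin.
have mu3B : mu3 B = ((r *+ 2) ^+ 3)%:E by apply: lebesgue3_box; exact: ltW.
rewrite fi integral_cst// [X in (_ * X)%E]mu3B -EFinM lee_fin leNgt => /negP; apply.
by rewrite mulr_gt0 ?divr_gt0// exprn_gt0// pmulrn_lgt0.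
Unshelve. all: by end_near.
Qed.
End VolumeDefinite.

(** * Affine change of variables *)

Section ScaledIntegral.
Local Open Scope ereal_scope.
Variables (d : measure_display) (T : measurableType d) (R : realType).
Variables (m : {measure set T -> \bar R}) (k : {nonneg R}).

Lemma integral_mscale D f : measurable D -> m.-integrable D f ->
  \int[mscale k m]_(x in D) f x = k%:num%:E * \int[m]_(x in D) f x.
Proof.
move=> mD fi; have mf := measurable_int m fi.
have fp : \int[m]_(x in D) f^\+ x \is a fin_num.
  by apply: integrable_fin_num => //; exact: integrable_funepos.
have fn : \int[m]_(x in D) f^\- x \is a fin_num.
  by apply: integrable_fin_num => //; exact: integrable_funeneg.
rewrite [LHS]integralE [in RHS]integralE muleBr//; last exact: fin_num_adde_defr.
rewrite (ge0_integral_mscale m mD k)//; last exact: measurable_funepos.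
by rewrite (ge0_integral_mscale m mD k)//; exact: measurable_funeneg.
Qed.
End ScaledIntegral.

Section AffineChange.
Variable R : realType.
Local Notation mu := (@lebesgue_measure R).
Local Notation mu3 := (mu \x mu \x mu)%E.
Variables (A : 'M[R]_3) (v : 'rV[R]_3).
Hypothesis A0 : \det A != 0.

Definition affine3 (x : R * R * R) : R * R * R := unvec3 (v + vec3 x *m A).

Lemma vec3_affine3 x : vec3 (affine3 x) = v + vec3 x *m A.
Proof. exact: unvec3K. Qed.

Lemma measurable_unvec3 d (T : measurableType d) (xi : T -> 'rV[R]_3) :
  (forall k, measurable_fun setT (fun t => xi t 0 k)) ->
  measurable_fun setT (fun t => unvec3 (xi t)).
Proof.
by move=> mxi; apply: measurable_fun_pair => //; exact: measurable_fun_pair.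
Qed.

Lemma measurable_affine3 : measurable_fun setT affine3.
Proof.
apply: measurable_unvec3 => k.
have mk j : measurable_fun setT (fun t : R * R * R => vec3 t 0 j).
  exact: measurable_vec3.
apply: (eq_measurable_fun (fun t => v 0 k + (vec3 t 0 0 * A 0 k +
    vec3 t 0 1 * A 1 k + vec3 t 0 2 * A 2 k))).
  by move=> t _; rewrite [RHS]mxE [X in _ = _ + X]mxE sum_ord3.
by do 3 ?[apply: measurable_funD] => //; apply: measurable_funM.
Qed.

Lemma lebesgue3_affine3 E : measurable E ->
  mu3 (affine3 @^-1` E) = (`|\det A|^-1%:E * mu3 E)%E.
Proof.
move=> mE; pose t (x : R * R * R) := unvec3 (v + vec3 x).
have mt : measurable (t @^-1` E).
  rewrite -[X in measurable X]setTI.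
  suff : measurable_fun setT t by apply.
  apply: measurable_unvec3 => k.
  apply: (eq_measurable_fun (fun t => v 0 k + vec3 t 0 k)).
    by move=> s _; rewrite [RHS]mxE.
  by apply: measurable_funD => //; exact: measurable_vec3.
rewrite -(lebesgue3_translate v mE) -(scales_by_det_unit A0 mt); congr (mu3 _).
by apply/seteqP; split => x /=; rewrite /affine3 /t vec3_lin3.
Qed.

(** Up to the factor |det A|, the Lebesgue measure is its own image by the map. *)
Lemma integral_affine3 (D : set (R * R * R)) (f : R * R * R -> R) :
  measurable D -> measurable_fun setT f ->
  mu3.-integrable (affine3 @^-1` D) (EFin \o (f \o affine3)) ->
  \int[mu3]_(x in D) f x = `|\det A| * \int[mu3]_(x in affine3 @^-1` D) f (affine3 x).
Proof.
move=> mD mf fi; rewrite /Rintegral.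
pose k := NngNum (normr_ge0 (\det A)).
pose T := (measurableTypeR R * measurableTypeR R * measurableTypeR R)%type.
pose phi : T -> T := affine3.
have mphi : measurable_fun setT phi := measurable_affine3.
pose nu0 : {measure set T -> \bar R} := pushforward mu3 phi.
pose nu := nu0 mphi.
have -> : (\int[mu3]_(x in D) (f x)%:E = \int[mscale k nu]_(x in D) (f x)%:E)%E.
  apply: eq_measure_integral => E mE _.
  suff : mu3 E = (`|\det A|%:E * mu3 (affine3 @^-1` E))%E by [].
  by rewrite lebesgue3_affine3// muleA -EFinM divff ?normr_eq0// mul1e.
have fi' : nu.-integrable D (EFin \o f).
  by apply: integrable_pushforward => //; exact/measurable_EFinP.
have -> := @integral_mscale _ _ _ nu k D (EFin \o f) mD fi'.
have fin := @integrable_fin_num _ _ _ nu D mD _ fi'.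
rewrite -(fineK fin) -EFinM [LHS]/fine.
have mf' : measurable_fun [set: T] (EFin \o f) by exact/measurable_EFinP.
have H : (\int[nu]_(x in D) (EFin \o f) x =
    \int[mu3]_(x in phi @^-1` D) ((EFin \o f) \o phi) x)%E.
  exact: (@integral_pushforward _ _ T T R phi mphi mu3 D (EFin \o f) mf' fi mD).
rewrite H.
by [].
Qed.
End AffineChange.

(** * The tetrahedron fibred by segments parallel to an edge *)

Section Parts.
Variable R : realType.
Local Notation C := R[i].
Implicit Types P : mpoly 3 C.

(** Fubini and the fundamental theorem of calculus apply to real functions; the
    boolean lets both parts of a complex integrand be treated at once. *)
Definition cpart (re : bool) (z : C) : R := if re then complex.Re z else complex.Im z.

Lemma measurable_cpart re d (T : measurableType d) (xi : T -> 'rV[R]_3) P :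
  (forall k, measurable_fun setT (fun t => xi t 0 k)) ->
  measurable_fun setT (fun t => cpart re (peval P (xi t))).
Proof. by move=> /(measurable_peval P)[? ?]; case: re. Qed.

Lemma continuous_cpart re (T : topologicalType) (xi : T -> 'rV[R]_3) P :
  (forall k, continuous (fun t => xi t 0 k : R)) ->
  continuous (fun t => cpart re (peval P (xi t))).
Proof. by move=> /(continuous_peval P)[? ?]; case: re. Qed.

Lemma is_derive_cpart re (x b : 'rV[R]_3) P (t : R) :
  is_derive t 1 (fun t => cpart re (peval P (x + t *: b)))
    (cpart re (peval (pdir b P) (x + t *: b))).
Proof. by have [? ?] := is_derive_peval x b P t; case: re. Qed.

(** The fundamental theorem of calculus along a segment of direction b. *)
Lemma integral_line re (x b : 'rV[R]_3) P (l : R) : 0 <= l ->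
  (\int[@lebesgue_measure R]_(t in `[0%R, l])
     (cpart re (peval (pdir b P) (x + t *: b)))%:E =
   (cpart re (peval P (x + l *: b)) - cpart re (peval P x))%:E)%E.
Proof.
rewrite le_eqVlt => /predU1P[<-|l0].
  by rewrite set_itv1 integral_set1 scale0r addr0 subrr.
have cP (Q : mpoly 3 R[i]) : continuous (fun t : R => cpart re (peval Q (x + t *: b))).
  by apply: continuous_cpart => k; exact: continuous_line.
rewrite (@continuous_FTC2 _ _ (fun t => cpart re (peval P (x + t *: b))))//.
- by rewrite scale0r addr0.
- by apply: continuous_subspaceT => t; exact: cP.
- split => [t _||]; first by have [] := is_derive_cpart re x b P t.
    by apply: cvg_at_right_filter; exact: cP.
  by apply: cvg_at_left_filter; exact: cP.
- move=> t _; rewrite derive1E.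
  exact: (@derive_val _ _ _ _ _ _ _ (is_derive_cpart re x b P t)).
Qed.
End Parts.

Section FaceGeometry.
Variables (R : realType) (a : 'I_4 -> 'rV[R]_3).
Implicit Types (i : 'I_4) (q r : 'I_3) (s : R * R).

(** The barycentric coordinates of a point of the reference triangle. *)
Definition tri_weight q s : R := nth 0 [:: 1 - s.1 - s.2; s.1; s.2] q.

Lemma unit_triangleP s : unit_triangle s <-> forall q, 0 <= tri_weight q s.
Proof.
split=> [[s1 s2 s12] q|w0].
  by case: (ord3P q) => ->; rewrite /tri_weight //= -addrA -opprD subr_ge0.
have := w0 0; have := w0 1; have := w0 2; rewrite /tri_weight /= => s2 s1.
by rewrite -addrA -opprD subr_ge0.
Qed.

Lemma tri_weight_sum s : \sum_q tri_weight q s = 1.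
Proof. by rewrite sum_ord3 /tri_weight /=; ring. Qed.

Lemma face_paramE i s :
  face_param a i s = \sum_q tri_weight q s *: face_vertex a i q.
Proof.
apply/rowP => k; rewrite summxE sum_ord3 /face_param /face_edge1 /face_edge2 !mxE.
by rewrite /tri_weight /=; ring.
Qed.

(** The vertices of index r and r + 1 are joined by the edge [pair_edge]. The
    face parametrizations list the vertices of a face in increasing order.
    Because the two indices are consecutive, the vertex lists of the faces
    opposite to these two vertices differ only in position r, where one has
    a_r and the other a_(r+1). So the two parametrizations differ by a
    multiple of the edge, the weight of position r ([face_param_prev]). *)
Section AdjacentFaces.
Variable r : 'I_3.
Definition vnext : 'I_4 := lift ord0 r.
Definition vprev : 'I_4 := widen_ord (leqnSn 3) r.
Definition pair_edge := a vnext - a vprev.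

Lemma face_vertex_next : face_vertex a vnext r = a vprev.
Proof.
rewrite /face_vertex; congr a; apply/val_inj => /=.
by rewrite /bump /= ?leq0n ?add1n ltnn.
Qed.

Lemma face_vertex_prev : face_vertex a vprev r = a vnext.
Proof.
by rewrite /face_vertex; congr a; apply/val_inj; rewrite /= /bump /= leqnn.
Qed.

Lemma face_vertex_common q : q != r -> face_vertex a vnext q = face_vertex a vprev q.
Proof.
move=> qr; rewrite /face_vertex; congr a; apply/val_inj => /=.
rewrite /bump /= ?leq0n ?add1n; congr (_ + _)%N.
by rewrite ltn_neqAle eq_sym qr.
Qed.

Lemma face_param_prev s :
  face_param a vprev s = face_param a vnext s + tri_weight r s *: pair_edge.
Proof.
rewrite !face_paramE (bigD1 r)//= [in RHS](bigD1 r)//= face_vertex_next face_vertex_prev.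
rewrite /pair_edge scalerBr addrAC; congr (_ + _).
  by rewrite addrC subrK.
by apply: eq_bigr => q qr; rewrite face_vertex_common.
Qed.

Hypothesis nd : tetra_nondegenerate a.

(** The barycentric coordinates of the point are those of the face parametrization,
    except that t is taken from vertex r and given to vertex r + 1. Therefore the
    tetrahedron is a union of segments parallel to the edge, from one face to the
    other. *)
Lemma tetra_fiber s (t : R) :
  tetrahedron a (face_param a vnext s + t *: pair_edge) <->
  unit_triangle s /\ 0 <= t <= tri_weight r s.
Proof.
pose w (i : 'I_4) : R :=
  if unlift vnext i is Some q then tri_weight q s - (q == r)%:R * t else t.
have wE : face_param a vnext s + t *: pair_edge = \sum_i w i *: a i.
  rewrite (bigD1_ord vnext)//= {1}/w unlift_none face_paramE.
  under [in RHS]eq_bigr do rewrite /w liftK scalerBl.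
  rewrite sumrB.
  have -> : \sum_q (((q == r)%:R * t) *: a (lift vnext q)) = t *: a vprev.
    rewrite (bigD1 r)//= big1 ?addr0 => [|q /negbTE ->]; last by rewrite mul0r scale0r.
    by rewrite eqxx mul1r -[a (lift vnext r)]/(face_vertex a vnext r) face_vertex_next.
  by rewrite /pair_edge scalerBr addrCA.
have w1 : \sum_i w i = 1.
  rewrite (bigD1_ord vnext)//= {1}/w unlift_none.
  under [in LHS]eq_bigr do rewrite /w liftK.
  rewrite sumrB tri_weight_sum.
  have -> : \sum_q ((q == r)%:R * t) = t.
    rewrite (bigD1 r)//= big1 ?addr0 => [|q /negbTE ->]; last by rewrite mul0r.
    by rewrite eqxx mul1r.
  by rewrite addrC subrK.
rewrite (tetrahedronP nd) wE; have wb := bary_unique nd w1 erefl.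
split=> [b0|[/unit_triangleP s0 /andP[t0 tr]] i]; last first.
  rewrite -wb /w; case: unliftP => // q _.
  have [->|_] := eqVneq q r; first by rewrite mul1r subr_ge0.
  by rewrite mul0r subr0.
have t0 : 0 <= t by have := b0 vnext; rewrite -wb /w unlift_none.
have wq q : 0 <= tri_weight q s - (q == r)%:R * t.
  by have := b0 (lift vnext q); rewrite -wb /w liftK.
have tr : t <= tri_weight r s by have := wq r; rewrite eqxx mul1r subr_ge0.
split; last by rewrite t0.
apply/unit_triangleP => q; have [->|qr] := eqVneq q r; first exact: le_trans tr.
by have := wq q; rewrite (negbTE qr) mul0r subr0.
Qed.
End AdjacentFaces.
End FaceGeometry.

(** * Integration over the faces *)

Section FaceFunctional.
Variables (R : realType) (a : 'I_4 -> 'rV[R]_3) (i : 'I_4).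
Local Notation C := R[i].
Local Notation mu := (@lebesgue_measure R).
Local Notation mu2 := (mu \x mu)%E.
Implicit Types P Q : mpoly 3 C.
Local Notation T := (@unit_triangle R).

Lemma measurable_tri_weight q : measurable_fun setT (@tri_weight R q).
Proof.
case: (ord3P q) => ->; rewrite /tri_weight /=;
  [|exact: measurable_fst|exact: measurable_snd].
by do 2 ?[apply: measurable_funB] => //.
Qed.

Lemma measurable_unit_triangle : measurable T.
Proof.
have -> : T = \bigcap_(q in [set: 'I_3]) (@tri_weight R q @^-1` `[0, +oo[%classic).
  apply/seteqP; split => s /=.
    by move/unit_triangleP => s0 q _ /=; rewrite in_itv/= s0.
  by move=> s0; apply/unit_triangleP => q; have := s0 q I; rewrite /= in_itv/= andbT.
apply: fin_bigcap_measurable => // q _; rewrite -[X in measurable X]setTI.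
exact: (measurable_tri_weight q).
Qed.

Lemma finite_unit_triangle : (mu2 T < +oo)%E.
Proof.
have mb (r : R) : measurable (ball (0:R) r) by exact: measurable_ball.
apply: (@le_lt_trans _ _ (mu2 (ball (0:R) 2 `*` ball (0:R) 2))).
  apply: le_measure; rewrite ?inE.
  - exact: measurable_unit_triangle.
  - by apply: measurableX; exact: mb.
  - move=> [x y] [/= x0 y0 xy]; split; rewrite /ball /= sub0r normrN ger0_norm//; lra.
have -> : mu2 (ball (0:R) 2 `*` ball (0:R) 2) =
    (mu (ball (0%R:R) 2%R) * mu (ball (0%R:R) 2%R))%E.
  by apply: product_measure1E; exact: mb.
by rewrite !lebesgue_measure_ball// -EFinM ltry.
Qed.

Lemma measurable_face_param k :
  measurable_fun setT (fun s => face_param a i s 0 k).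
Proof.
apply: (eq_measurable_fun (fun s : R * R => face_vertex a i 0 0 k +
   s.1 * face_edge1 a i 0 k + s.2 * face_edge2 a i 0 k)).
  by move=> s _; rewrite /face_param !mxE.
do 2 ?[apply: measurable_funD] => //; apply: measurable_funM => //;
  first [exact: measurable_fst|exact: measurable_snd].
Qed.

Lemma face_param_in_face s : T s -> face a i (face_param a i s).
Proof.
move=> /unit_triangleP s0.
exists (fun l => if unlift i l is Some q then tri_weight q s else 0); split.
- by move=> j; case: unliftP.
- rewrite (bigD1_ord i)//= unlift_none add0r.
  by under eq_bigr do rewrite liftK; exact: tri_weight_sum.
- by rewrite unlift_none.
- rewrite (bigD1_ord i)//= unlift_none scale0r add0r face_paramE.
  by under [in RHS]eq_bigr do rewrite liftK.
Qed.

Lemma bounded_face_param : exists M : R,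
  forall s, T s -> forall k, `|face_param a i s 0 k| <= M.
Proof.
have [M bM] := bounded_tetrahedron a; exists M => s /face_param_in_face.
by move=> [t [t0 t1 _ ->]] k; apply: bM; exists t.
Qed.

Definition tri_int P : C := pull_int mu2 T (face_param a i) P.

Lemma integrable_tri_int re P :
  mu2.-integrable T (EFin \o (fun s => cpart re (peval P (face_param a i s)))).
Proof.
have [? ?] :
    mu2.-integrable T (EFin \o (fun s => complex.Re (peval P (face_param a i s)))) /\
    mu2.-integrable T (EFin \o (fun s => complex.Im (peval P (face_param a i s)))).
  by apply: integrable_peval; [exact: measurable_unit_triangle|
    exact: finite_unit_triangle|exact: measurable_face_param|exact: bounded_face_param].
by case: re.
Qed.

Lemma tri_int_add P Q : tri_int (P + Q) = tri_int P + tri_int Q.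
Proof. by apply: pull_int_add; [exact: measurable_unit_triangle|
    exact: finite_unit_triangle|exact: measurable_face_param|exact: bounded_face_param].
Qed.

Lemma tri_int_scale c P : tri_int (c *: P) = c * tri_int P.
Proof. by apply: pull_int_scale; [exact: measurable_unit_triangle|
    exact: finite_unit_triangle|exact: measurable_face_param|exact: bounded_face_param].
Qed.

Lemma tri_int_conj P : tri_int (pconj P) = (tri_int P)^*.
Proof. by apply: pull_int_conj; [exact: measurable_unit_triangle|
    exact: finite_unit_triangle|exact: measurable_face_param|exact: bounded_face_param].
Qed.

Lemma tri_int_ge0 P : 0 <= tri_int (P * pconj P).
Proof. exact: pull_int_ge0. Qed.
End FaceFunctional.

(** * Fubini along the segments *)

Section Fiber.
Variables (R : realType) (a : 'I_4 -> 'rV[R]_3).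
Hypothesis nd : tetra_nondegenerate a.
Variable r : 'I_3.
Local Notation C := R[i].
Local Notation mu := (@lebesgue_measure R).
Local Notation mu2 := (mu \x mu)%E.
Local Notation mu3 := (mu \x mu \x mu)%E.
Local Notation T := (@unit_triangle R).
Local Notation D := (@vec3 R @^-1` tetrahedron a).
Implicit Types P Q : mpoly 3 C.

Let b := pair_edge a r.
Let j := vnext r.

(** The linear part of the parametrization of the tetrahedron by a point of the
    reference triangle and a position along the segment through it. *)
Definition frame : 'M[R]_3 := \matrix_(k < 3)
  (if k == 0 then face_edge1 a j else if k == 1 then face_edge2 a j else b).

(** The determinant is the triple product of two edges of the face and the
    moving edge; the latter has the same height over the face as the opposite
    vertex. *)
Lemma det_frame : \det frame = dot (face_cross a j) (a j - face_vertex a j 0).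
Proof.
rewrite /frame det_rows /=.
have -> : dot (face_cross a j) (a j - face_vertex a j 0) = dot (face_cross a j) b.
  have /eqP := face_cross_orth a j r; rewrite dotB subr_eq0 => /eqP orth.
  by rewrite !dotB -orth face_vertex_next.
rewrite /face_cross !dotE; have [-> -> ->] := crossE (face_edge2 a j) b.
have [-> -> ->] := crossE (face_edge1 a j) (face_edge2 a j).
ring.
Qed.

Lemma det_frame_neq0 : \det frame != 0.
Proof. by rewrite det_frame -sqrf_eq0 face_cross_det sqrf_eq0. Qed.

Let phi := affine3 frame (face_vertex a j 0).

Lemma vec3_fiber x : vec3 (phi x) = face_param a j x.1 + x.2 *: b.
Proof.
rewrite vec3_affine3; apply/rowP => k.
by rewrite /face_param !mxE sum_ord3 !mxE /= -!addrA.
Qed.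

(** The tetrahedron in the coordinates given by [frame]. *)
Definition slab : set ((R * R) * R) :=
  [set x | unit_triangle x.1 /\ 0 <= x.2 <= tri_weight r x.1].

Lemma preimage_tetra : phi @^-1` D = slab.
Proof.
by apply/seteqP; split => x /=; rewrite vec3_fiber => /(tetra_fiber r nd).
Qed.

Lemma measurable_slab : measurable slab.
Proof.
rewrite -preimage_tetra -[X in measurable X]setTI.
by apply: measurable_affine3 => //; exact: measurable_tetra.
Qed.

Lemma finite_slab : (mu3 slab < +oo)%E.
Proof.
rewrite -preimage_tetra lebesgue3_affine3;
  [|exact: det_frame_neq0|exact: measurable_tetra].
by rewrite lte_mul_pinfty ?lee_fin// finite_tetra.
Qed.

Lemma integrable_slab re P :
  mu3.-integrable slab (EFin \o (fun x => cpart re (peval P (vec3 (phi x))))).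
Proof.
have mphi k : measurable_fun setT (fun x => vec3 (phi x) 0 k).
  exact: (measurableT_comp (@measurable_vec3 R k)
    (measurable_affine3 frame (face_vertex a j 0))).
have [? ?] : mu3.-integrable slab (EFin \o (fun x => complex.Re (peval P (vec3 (phi x)))))
  /\ mu3.-integrable slab (EFin \o (fun x => complex.Im (peval P (vec3 (phi x))))).
  apply: integrable_peval; [exact: measurable_slab|exact: finite_slab|exact: mphi|].
  by have [M bM] := bounded_vec3 a; exists M => t; rewrite -preimage_tetra => /bM.
by case: re.
Qed.

(** Integrating first along the segments leaves the difference of the values at
    their two ends, which lie on the two faces. *)
Lemma integral_slab re P :
  (\int[mu3]_(x in slab) (cpart re (peval (pdir b P) (vec3 (phi x))))%:E =
   \int[mu2]_(s in T) (cpart re (peval P (face_param a (vprev r) s))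
      - cpart re (peval P (face_param a j s)))%:E)%E.
Proof.
rewrite integral_mkcond [RHS]integral_mkcond.
pose mu2s := product_measure1_sfm mu mu.
have fi := integrable_slab re (pdir b P).
rewrite -(@integral12_prod_meas1 _ _ _ _ R mu2s mu); last first.
  have mk := @integrable_mkcond _ _ R mu3 slab
    (EFin \o (fun x => cpart re (peval (pdir b P) (vec3 (phi x))))).
  have [+ _] := mk measurable_slab.
  by apply.
apply: eq_integral => s _; rewrite /fubini_F.
have [sT|sT] := boolP (s \in T); last first.
  rewrite [RHS]patchE (negbTE sT) integral0_eq// => t _.
  rewrite patchE ifF//; apply/negbTE; apply: contra sT.
  by rewrite !inE => -[].
rewrite [RHS]patchE sT face_param_prev -integral_line; last first.
  by move: sT; rewrite inE => /unit_triangleP.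
rewrite [RHS]integral_mkcond; apply: eq_integral => t _.
rewrite !patchE; congr (if _ then _ else _); last by rewrite vec3_fiber.
apply/idP/idP; rewrite !inE /slab /= in_itv /=; first by case.
by move=> ?; split=> //; move: sT; rewrite inE.
Qed.
End Fiber.

(** * The divergence theorem *)

Section Divergence.
Variables (R : realType) (a : 'I_4 -> 'rV[R]_3).
Hypothesis nd : tetra_nondegenerate a.
Local Notation C := R[i].
Local Notation mu := (@lebesgue_measure R).
Local Notation mu2 := (mu \x mu)%E.
Local Notation mu3 := (mu \x mu \x mu)%E.
Local Notation T := (@unit_triangle R).
Local Notation D := (@vec3 R @^-1` tetrahedron a).
Implicit Types P Q : mpoly 3 C.

Lemma cpart_vol_int_edge re r P :
  cpart re (vol_int a (pdir (pair_edge a r) P)) =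
  `|\det (frame a r)| *
    (cpart re (tri_int a (vprev r) P) - cpart re (tri_int a (vnext r) P)).
Proof.
have cv Q : cpart re (vol_int a Q) = \int[mu3]_(x in D) cpart re (peval Q (vec3 x)).
  by case: re.
have ct i Q : cpart re (tri_int a i Q) =
    \int[mu2]_(s in T) cpart re (peval Q (face_param a i s)).
  by case: re {cv}.
rewrite cv !ct (@integral_affine3 _ (frame a r) (face_vertex a (vnext r) 0)
   (det_frame_neq0 nd r) D (fun x => cpart re (peval (pdir (pair_edge a r) P) (vec3 x)))).
- rewrite preimage_tetra//; congr (_ * _).
  rewrite -RintegralB; [|exact: measurable_unit_triangle|exact: integrable_tri_int..].
  rewrite /Rintegral; congr fine; exact: integral_slab.
- exact: measurable_tetra.
- by apply: measurable_cpart; exact: measurable_vec3.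
- by rewrite preimage_tetra//; exact: integrable_slab.
Qed.

(** The case of the divergence theorem for the derivative along an edge, before
    the normals are brought in. *)
Lemma vol_int_edge r P : vol_int a (pdir (pair_edge a r) P) =
  `|\det (frame a r)|%:C * (tri_int a (vprev r) P - tri_int a (vnext r) P).
Proof.
have := cpart_vol_int_edge true r P; have := cpart_vol_int_edge false r P => /= I1 R1.
apply: complexext; rewrite ?Re_mul ?Im_mul /= mul0r ?subr0 ?addr0 ?R1 ?I1.
  by case: (tri_int a (vprev r) P) => ? ?; case: (tri_int a (vnext r) P).
by case: (tri_int a (vprev r) P) => ? ?; case: (tri_int a (vnext r) P).
Qed.

(** Up to sign, this is six times the volume of the tetrahedron, whatever the
    face. *)
Definition height i : R := dot (face_cross a i) (a i - face_vertex a i 0).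

Lemma norm_height i k : `|height i| = `|height k|.
Proof.
by apply/eqP; rewrite -(@eqrXn2 _ 2)// !real_normK ?num_real// !face_cross_det.
Qed.

Lemma dot_face_cross_vertex i k l : k != i -> l != i ->
  dot (face_cross a i) (a k - a l) = 0.
Proof.
rewrite ![_ == i]eq_sym => /unlift_some[k' -> _] /unlift_some[l' -> _].
rewrite dotB; have /eqP := face_cross_orth a i k'; have /eqP := face_cross_orth a i l'.
by rewrite !dotB !subr_eq0 /face_vertex => /eqP -> /eqP ->; rewrite subrr.
Qed.

Lemma dot_face_cross_opposite i l : l != i ->
  dot (face_cross a i) (a i - a l) = height i.
Proof.
move=> li; rewrite /height !dotB; congr (_ - _).
have := @dot_face_cross_vertex i l (lift i 0) li; rewrite eq_sym neq_lift => /(_ isT).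
by rewrite dotB => /eqP; rewrite subr_eq0 => /eqP.
Qed.

(** The surface integral: the parametrization has constant area density. *)
Definition face_int i P : C := (norm2 (face_cross a i))%:C * tri_int a i P.

Lemma norm2_neq0 i : norm2 (face_cross a i) != 0.
Proof.
have [n1 _ _] := face_normalP i nd.
apply: contraTneq (oner_neq0 R) => n0; rewrite negbK -n1 /face_normal n0.
by rewrite invr0 mulr0 oppr0 scale0r /dot big1// => k _; rewrite mxE mul0r.
Qed.

(** The norm of the cross product in the area density cancels the one that
    normalizes the normal. *)
Lemma normal_face_int i k P : (face_normal a i 0 k)%:C * face_int i P =
  (- (Num.sg (height i) * face_cross a i 0 k))%:C * tri_int a i P.
Proof.
rewrite /face_int mulrA -rmorphM /face_normal mxE -/(height i); congr (_%:C * _).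
by have n0 := norm2_neq0 i; field.
Qed.

(** The edge is parallel to the two faces containing it, so these do not
    contribute; over the two others its height is plus or minus that of the
    opposite vertex, and the outward orientation fixes the signs. *)
Lemma divergence_edge r P :
  \sum_k (pair_edge a r 0 k)%:C * vol_int a (mderiv k P) =
  \sum_k (pair_edge a r 0 k)%:C * \sum_i (face_normal a i 0 k)%:C * face_int i P.
Proof.
transitivity (vol_int a (pdir (pair_edge a r) P)).
  rewrite pdirE vol_int_sum//; apply: eq_bigr => k _; exact/esym/vol_int_scale.
pose t i := tri_int a i P.
rewrite vol_int_edge -/(t _) -/(t _).
have -> : \sum_k (pair_edge a r 0 k)%:C * \sum_i (face_normal a i 0 k)%:C * face_int i P =
   \sum_i (- (Num.sg (height i) * dot (face_cross a i) (pair_edge a r)))%:C * t i.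
  under eq_bigr do rewrite mulr_sumr.
  rewrite exchange_big; apply: eq_bigr => i _ /=.
  under eq_bigr do rewrite normal_face_int mulrA -rmorphM.
  rewrite -mulr_suml -rmorph_sum /=; congr (_%:C * _).
  rewrite /dot mulr_sumr -sumrN; apply: eq_bigr => k _; ring.
clearbody t.
have pn : vprev r != vnext r.
  by rewrite -val_eqE /= /bump /= neq_ltn ltnSn.
rewrite (bigD1 (vnext r))//= (bigD1 (vprev r))//=.
rewrite [X in _ + (_ + X)]big1 ?addr0; last first.
  by move=> i /andP[iN iP]; rewrite dot_face_cross_vertex 1?eq_sym// mulr0 oppr0 mul0r.
have -> : dot (face_cross a (vnext r)) (pair_edge a r) = height (vnext r).
  exact: dot_face_cross_opposite.
have -> : dot (face_cross a (vprev r)) (pair_edge a r) = - height (vprev r).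
  rewrite /pair_edge -opprB -(dot_face_cross_opposite (l := vnext r)) 1?eq_sym//.
  by rewrite /dot -sumrN; apply: eq_bigr => k _; rewrite !mxE mulrN.
rewrite mulrN opprK -!normrEsg det_frame -/(height _).
rewrite (norm_height (vprev r) (vnext r)) rmorphN mulNr mulrBr addrC.
by [].
Qed.

(** Both sides define linear forms in the direction of derivation that agree on
    the three edges between consecutive vertices. Adding these edges gives all
    the edges issued from the first vertex, which form a basis. *)
Lemma divergence k P :
  vol_int a (mderiv k P) = \sum_i (face_normal a i 0 k)%:C * face_int i P.
Proof.
pose y l : C := vol_int a (mderiv l P) - \sum_i (face_normal a i 0 l)%:C * face_int i P.
pose ell (v : 'rV[R]_3) := \sum_l (v 0 l)%:C * y l.
have ellB u v : ell (u - v) = ell u - ell v.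
  by rewrite /ell -sumrB; apply: eq_bigr => l _; rewrite !mxE rmorphB mulrBl.
(* moving along the edges from one vertex to the next *)
have step r : ell (a (vnext r)) = ell (a (vprev r)).
  apply/eqP; rewrite -subr_eq0 -ellB; apply/eqP; rewrite /ell /y.
  under eq_bigr do rewrite mulrBr.
  by rewrite sumrB divergence_edge subrr.
have all0 i : ell (a i) = ell (a ord0).
  case: i => n; elim: n => [|n IH] hn; first by congr (ell (a _)); exact/val_inj.
  have hn' : (n < 3)%N by [].
  rewrite -(IH (ltnW hn)).
  have -> : Ordinal hn = vnext (Ordinal hn') by exact/val_inj.
  by rewrite step; congr (ell (a _)); exact/val_inj.
have : map_mx (real_complex R) (edgemx a) *m (\col_l y l) = 0.
  apply/colP => l; rewrite mxE.
  transitivity (ell (a (lift ord0 l) - a ord0)); last by rewrite ellB all0 subrr mxE.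
  by apply: eq_bigr => q _; rewrite !mxE.
move=> /(congr1 (mulmx (invmx (map_mx (real_complex R) (edgemx a))))).
rewrite mulmxA mulVmx ?mul1mx ?mulmx0; last first.
  by rewrite map_unitmx; exact: edgemx_unit.
move=> /colP/(_ k); rewrite !mxE => /eqP; rewrite subr_eq0 => /eqP.
by [].
Qed.
End Divergence.

(** * Dot and cross products *)

Section VectorAlgebra.
Variable A : comNzRingType.
Implicit Types (c : A) (u v w n : 'rV[A]_3).

Lemma dot3E u v : dot u v = u 0 0 * v 0 0 + u 0 1 * v 0 1 + u 0 2 * v 0 2.
Proof. exact: sum_ord3. Qed.

Lemma cross3E u v :
  (cross u v 0 0 = u 0 1 * v 0 2 - u 0 2 * v 0 1) *
  (cross u v 0 1 = u 0 2 * v 0 0 - u 0 0 * v 0 2) *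
  (cross u v 0 2 = u 0 0 * v 0 1 - u 0 1 * v 0 0).
Proof.
by split; [split|]; rewrite mxE; congr (_ * _ - _ * _); congr (_ _ _); apply/val_inj.
Qed.

Lemma rV3P u v : u 0 0 = v 0 0 -> u 0 1 = v 0 1 -> u 0 2 = v 0 2 -> u = v.
Proof. by move=> u0 u1 u2; apply/rowP => k; case: (ord3P k) => ->. Qed.

Lemma dotDl u v w : dot (u + v) w = dot u w + dot v w.
Proof. by rewrite /dot -big_split; apply: eq_bigr => k _; rewrite mxE mulrDl. Qed.

Lemma dotDr u v w : dot w (u + v) = dot w u + dot w v.
Proof. by rewrite /dot -big_split; apply: eq_bigr => k _; rewrite mxE mulrDr. Qed.

Lemma dotZl c u v : dot (c *: u) v = c * dot u v.
Proof. by rewrite /dot mulr_sumr; apply: eq_bigr => k _; rewrite mxE mulrA. Qed.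

Lemma dotZr c u v : dot u (c *: v) = c * dot u v.
Proof. by rewrite /dot mulr_sumr; apply: eq_bigr => k _; rewrite mxE mulrCA. Qed.

Lemma crossDr n u v : cross n (u + v) = cross n u + cross n v.
Proof. by apply/rowP => k; rewrite !mxE; ring. Qed.

Lemma crossZr c n u : cross n (c *: u) = c *: cross n u.
Proof. by apply/rowP => k; rewrite !mxE; ring. Qed.

Lemma dot_cross_skew n u v : dot (cross n u) v = - dot u (cross n v).
Proof. by rewrite !dot3E !cross3E; ring. Qed.

Lemma dot_cross_triple n u v : dot (cross n u) v = dot n (cross u v).
Proof. by rewrite !dot3E !cross3E; ring. Qed.

Lemma cross_cross n w : cross n (cross n w) = dot n w *: n - dot n n *: w.
Proof. by apply: rV3P; rewrite !cross3E !mxE !dot3E; ring. Qed.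

Lemma cross_cross_cross n u : dot n n = 1 ->
  cross n (cross n (cross n u)) = - cross n u.
Proof.
move=> n1; rewrite [LHS]cross_cross n1 scale1r.
suff -> : dot n (cross n u) = 0 by rewrite scale0r sub0r.
by rewrite !dot3E !cross3E; ring.
Qed.
End VectorAlgebra.

Lemma map_dot (A B : comNzRingType) (f : {rmorphism A -> B}) (u v : 'rV[A]_3) :
  f (dot u v) = dot (map_mx f u) (map_mx f v).
Proof. by rewrite rmorph_sum; apply: eq_bigr => k _; rewrite rmorphM !mxE. Qed.

(** * Sesquilinear forms on polynomial fields *)

(** Complex scalars act on fields as constant polynomials. *)
HB.lock Definition vscale (R : realType) (c : R[i]) (u : vpoly R) : vpoly R :=
  mpolyC 3 c *: u.

Section SesquilinearForm.
Variable R : realType.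
Local Notation C := R[i].
Local Notation pol := (mpoly 3 C).
Implicit Types (P Q : pol) (u v w : vpoly R) (c : C).

Definition vconj u : vpoly R := map_mx (@pconj R) u.

Lemma vscaleE c u : vscale c u = mpolyC 3 c *: u.
Proof. by rewrite vscale.unlock. Qed.

Lemma vconjD u v : vconj (u + v) = vconj u + vconj v.
Proof. by apply/rowP => k; rewrite !mxE pconjD. Qed.

Lemma vconjZ c u : vconj (vscale c u) = vscale c^* (vconj u).
Proof. by rewrite !vscaleE; apply/rowP => k; rewrite !mxE pconjM pconjC. Qed.

Lemma pconjK P : pconj (pconj P) = P.
Proof.
elim/mpoly_algebra_ind: P => [c|i|P Q IP IQ|P Q IP IQ].
- by rewrite !pconjC conjcK.
- by rewrite !pconjX.
- by rewrite !pconjD IP IQ.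
- by rewrite !pconjM IP IQ.
Qed.

Lemma pconj_dot u v : pconj (dot u (vconj v)) = dot v (vconj u).
Proof.
by rewrite !dot3E !pconjD !pconjM !mxE !pconjK ![pconj _ * _]mulrC.
Qed.

Variable L : pol -> C.
Hypothesis LD : forall P Q, L (P + Q) = L P + L Q.
Hypothesis LZ : forall c P, L (c *: P) = c * L P.
Hypothesis Lconj : forall P, L (pconj P) = (L P)^*.
Hypothesis L_ge0 : forall P, 0 <= L (P * pconj P).

(** Inner products of fields, for a functional L on polynomials that stands for
    an integral: over the tetrahedron or over a face. *)
Definition sesq u v : C := L (dot u (vconj v)).

Lemma sesqDl u v w : sesq (u + v) w = sesq u w + sesq v w.
Proof. by rewrite /sesq dotDl LD. Qed.

Lemma sesqDr u v w : sesq w (u + v) = sesq w u + sesq w v.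
Proof. by rewrite /sesq vconjD dotDr LD. Qed.

Lemma sesqZl c u v : sesq (vscale c u) v = c * sesq u v.
Proof. by rewrite vscaleE /sesq dotZl mul_mpolyC LZ. Qed.

Lemma sesqZr c u v : sesq u (vscale c v) = c^* * sesq u v.
Proof. by rewrite /sesq vconjZ vscaleE dotZr mul_mpolyC LZ. Qed.

Lemma vscaleN1 u : vscale (-1) u = - u.
Proof. by rewrite vscaleE mpolyCN scaleN1r. Qed.

Lemma sesqNl u v : sesq (- u) v = - sesq u v.
Proof. by rewrite -vscaleN1 sesqZl mulN1r. Qed.

Lemma sesqNr u v : sesq u (- v) = - sesq u v.
Proof. by rewrite -vscaleN1 sesqZr rmorphN1 mulN1r. Qed.

Lemma sesq_herm u v : sesq v u = (sesq u v)^*.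
Proof. by rewrite /sesq -Lconj pconj_dot. Qed.

Lemma sesq_ge0 u : 0 <= sesq u u.
Proof.
rewrite /sesq dot3E !LD !mxE.
by rewrite !addr_ge0// L_ge0.
Qed.

Lemma sesq_coord_eq0 u : sesq u u = 0 -> forall k, L (u 0 k * pconj (u 0 k)) = 0.
Proof.
have L0 k : 0 <= L (u 0 k * pconj (u 0 k)) by exact: L_ge0.
rewrite /sesq dot3E !LD !mxE => /eqP.
rewrite paddr_eq0 ?addr_ge0// paddr_eq0// => /andP[/andP[/eqP e0 /eqP e1] /eqP e2] k.
by case: (ord3P k) => ->.
Qed.

(** The equality case of the Cauchy-Schwarz inequality: otherwise the square of
    v + z u would be negative for a suitable scalar z. On a face the form is only
    semidefinite, as a polynomial may vanish on the face without being zero. *)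
Lemma sesq_isotropic u v : sesq u u = 0 -> sesq u v = 0.
Proof.
move=> u0; apply/eqP/negPn/negP => b0.
pose b := sesq u v; pose f := sesq v v.
have fJ : f^* = f by rewrite /f -sesq_herm.
have bJ0 : b * b^* != 0 by rewrite mulf_neq0 ?conjc_eq0.
(* this z makes each mixed term - (f + 1) / 2, so the square is -1 *)
pose z := - ((f + 1) / (2 * (b * b^*))) * b^*.
have zb : z * b = - ((f + 1) / 2).
  by rewrite /z; field; rewrite conjc_eq0 b0.
have := sesq_ge0 (v + vscale z u).
rewrite sesqDl !sesqDr !sesqZl !sesqZr u0 (sesq_herm u v) -/b -/f.
have -> : z^* * b^* = - ((f + 1) / 2).
  have cJ : conjc 2^-1 = 2^-1 :> C by rewrite fmorphV rmorph_nat.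
  transitivity (conjc (z * b)); first exact/esym/(rmorphM (@conjc R)).
  rewrite zb; apply: etrans (rmorphN (@conjc R) _) _; congr (- _).
  apply: etrans (rmorphM (@conjc R) _ _) _; congr (_ * _); last exact: cJ.
  by apply: etrans (rmorphD (@conjc R) _ _) _; congr (_ + _); [exact: fJ|exact: conjc1].
rewrite zb !mulr0 addr0.
have -> : f + - ((f + 1) / 2) + - ((f + 1) / 2) = -1 by field.
by rewrite oppr_ge0 ler10.
Qed.
End SesquilinearForm.

(** * Volume and face forms, and integration by parts *)

Lemma div_cross (A : comNzRingType) (D : 'I_3 -> A -> A) (u v : 'rV[A]_3) :
  (forall k, {morph D k : x y / x - y}) ->
  (forall k x y, D k (x * y) = D k x * y + x * D k y) ->
  let rot (w : 'rV[A]_3) : 'rV[A]_3 :=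
    \row_k (D (k + 1) (w 0 (k + 2)) - D (k + 2) (w 0 (k + 1))) in
  \sum_k D k (cross u v 0 k) = dot (rot u) v - dot u (rot v).
Proof.
move=> DB DM rot.
have rotE (w : 'rV[A]_3) : (rot w 0 0 = D 1 (w 0 2) - D 2 (w 0 1)) *
    (rot w 0 1 = D 2 (w 0 0) - D 0 (w 0 2)) *
    (rot w 0 2 = D 0 (w 0 1) - D 1 (w 0 0)).
  by split; [split|]; rewrite mxE; congr (D _ (w _ _) - D _ (w _ _)); apply/val_inj.
rewrite sum_ord3 !dot3E !cross3E !rotE !DB !DM; ring.
Qed.

HB.lock Definition vol_form (R : realType) (a : 'I_4 -> 'rV[R]_3)
  (u v : vpoly R) : R[i] := sesq (vol_int a) u v.

HB.lock Definition face_form (R : realType) (a : 'I_4 -> 'rV[R]_3) (i : 'I_4)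
  (u v : vpoly R) : R[i] := sesq (face_int a i) u v.

HB.lock Definition pnormal (R : realType) (a : 'I_4 -> 'rV[R]_3) (i : 'I_4) :
  vpoly R := map_mx (@mpolyC 3 R[i]) (cvec (face_normal a i)).

(** The rotated tangential trace, extended to a polynomial field on all of space. *)
HB.lock Definition pncross (R : realType) (a : 'I_4 -> 'rV[R]_3) (i : 'I_4)
  (u : vpoly R) : vpoly R := cross (pnormal a i) u.

Section FaceForms.
Variables (R : realType) (a : 'I_4 -> 'rV[R]_3).
Hypothesis nd : tetra_nondegenerate a.
Local Notation C := R[i].
Local Notation pol := (mpoly 3 C).
Implicit Types (P Q : pol) (u v w : vpoly R) (c : C) (i : 'I_4).

Lemma face_int_add i P Q : face_int a i (P + Q) = face_int a i P + face_int a i Q.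
Proof. by rewrite /face_int tri_int_add mulrDr. Qed.

Lemma face_int_scale i c P : face_int a i (c *: P) = c * face_int a i P.
Proof. by rewrite /face_int tri_int_scale mulrCA. Qed.

Lemma face_int_conj i P : face_int a i (pconj P) = conjc (face_int a i P).
Proof.
rewrite /face_int tri_int_conj; apply: etrans (esym (rmorphM (@conjc R) _ _)).
by congr (_ * _); rewrite /= oppr0.
Qed.

Lemma face_int_ge0 i P : 0 <= face_int a i (P * pconj P).
Proof. by rewrite /face_int mulr_ge0 ?tri_int_ge0// lecR sqrtr_ge0. Qed.

Local Notation vol_form := (vol_form a).
Local Notation face_form := (face_form a).
Local Notation pnormal := (pnormal a).
Local Notation pncross := (pncross a).

Lemma vol_formE u v : vol_form u v = sesq (vol_int a) u v.
Proof. by rewrite vol_form.unlock. Qed.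

Lemma face_formE i u v : face_form i u v = sesq (face_int a i) u v.
Proof. by rewrite face_form.unlock. Qed.

Lemma pnormalE i : pnormal i = map_mx (@mpolyC 3 C) (cvec (face_normal a i)).
Proof. by rewrite pnormal.unlock. Qed.

Lemma pncrossE i u : pncross i u = cross (pnormal i) u.
Proof. by rewrite pncross.unlock. Qed.

Definition ptan i u : vpoly R := - pncross i (pncross i u).

Lemma pnormal_unit i : dot (pnormal i) (pnormal i) = 1.
Proof.
rewrite pnormalE /cvec -!map_dot; have [-> _ _] := face_normalP i nd.
by rewrite !rmorph1.
Qed.

Lemma pconj_pnormal i k : pconj (pnormal i 0 k) = pnormal i 0 k.
Proof. by rewrite pnormalE !mxE pconjC conjc_real. Qed.

Lemma pconjB P Q : pconj (P - Q) = pconj P - pconj Q.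
Proof. by rewrite !pconjE; exact: raddfB. Qed.

Lemma vconj_pncross i u : vconj (pncross i u) = pncross i (vconj u).
Proof.
rewrite !pncrossE; apply/rowP => k.
by rewrite [LHS]mxE [cross _ _ 0 k]mxE pconjB !pconjM !pconj_pnormal !mxE.
Qed.

Lemma face_form_pncross i u v :
  face_form i (pncross i u) v = - face_form i u (pncross i v).
Proof.
rewrite !face_formE /sesq vconj_pncross !pncrossE dot_cross_skew.
by rewrite -scaleN1r face_int_scale mulN1r.
Qed.

Lemma pncross_cube i u : pncross i (pncross i (pncross i u)) = - pncross i u.
Proof. by rewrite !pncrossE; exact/cross_cross_cross/pnormal_unit. Qed.

Lemma pncrossD i u v : pncross i (u + v) = pncross i u + pncross i v.
Proof. by rewrite !pncrossE crossDr. Qed.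

Lemma pncrossZ i c u : pncross i (vscale c u) = vscale c (pncross i u).
Proof. by rewrite !pncrossE !vscaleE crossZr. Qed.

Lemma pncrossN i u : pncross i (- u) = - pncross i u.
Proof. by rewrite -!vscaleN1 pncrossZ. Qed.

Lemma ptanD i u v : ptan i (u + v) = ptan i u + ptan i v.
Proof. by rewrite /ptan !pncrossD opprD. Qed.

Lemma ptanZ i c u : ptan i (vscale c u) = vscale c (ptan i u).
Proof. by rewrite /ptan !pncrossZ !vscaleE scalerN. Qed.

Lemma pncross_ptan i u : pncross i (ptan i u) = pncross i u.
Proof. by rewrite /ptan pncrossN pncross_cube opprK. Qed.

Lemma face_formDl i u v w : face_form i (u + v) w = face_form i u w + face_form i v w.
Proof. by rewrite !face_formE (sesqDl (face_int_add i)). Qed.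

Lemma face_formDr i u v w : face_form i w (u + v) = face_form i w u + face_form i w v.
Proof. by rewrite !face_formE (sesqDr (face_int_add i)). Qed.

Lemma face_formZl i c u v : face_form i (vscale c u) v = c * face_form i u v.
Proof. by rewrite !face_formE (sesqZl (face_int_scale i)). Qed.

Lemma face_formZr i c u v : face_form i u (vscale c v) = conjc c * face_form i u v.
Proof. by rewrite !face_formE (sesqZr (face_int_scale i)). Qed.

Lemma face_formNl i u v : face_form i (- u) v = - face_form i u v.
Proof. by rewrite !face_formE (sesqNl (face_int_scale i)). Qed.

Lemma face_formNr i u v : face_form i u (- v) = - face_form i u v.
Proof. by rewrite !face_formE (sesqNr (face_int_scale i)). Qed.

Lemma face_form_herm i u v : face_form i v u = conjc (face_form i u v).
Proof. by rewrite !face_formE (sesq_herm (face_int_conj i)). Qed.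

Lemma face_form_ge0 i u : 0 <= face_form i u u.
Proof. by rewrite !face_formE (sesq_ge0 (face_int_add i) (face_int_ge0 i)). Qed.

Lemma face_form_isotropic i u v : face_form i u u = 0 -> face_form i u v = 0.
Proof.
rewrite !face_formE; apply: sesq_isotropic.
- exact: face_int_add.
- exact: face_int_scale.
- exact: face_int_conj.
- exact: face_int_ge0.
Qed.

Lemma vol_formDl u v w : vol_form (u + v) w = vol_form u w + vol_form v w.
Proof. by rewrite !vol_formE (sesqDl (vol_int_add nd)). Qed.

Lemma vol_formDr u v w : vol_form w (u + v) = vol_form w u + vol_form w v.
Proof. by rewrite !vol_formE (sesqDr (vol_int_add nd)). Qed.

Lemma vol_formZl c u v : vol_form (vscale c u) v = c * vol_form u v.
Proof. by rewrite !vol_formE (sesqZl (vol_int_scale nd)). Qed.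

Lemma vol_formNl u v : vol_form (- u) v = - vol_form u v.
Proof. by rewrite !vol_formE (sesqNl (vol_int_scale nd)). Qed.

Lemma vol_formZr c u v : vol_form u (vscale c v) = conjc c * vol_form u v.
Proof. by rewrite !vol_formE (sesqZr (vol_int_scale nd)). Qed.

Lemma vol_form_herm u v : vol_form v u = conjc (vol_form u v).
Proof. by rewrite !vol_formE (sesq_herm (vol_int_conj nd)). Qed.

Lemma vol_form_ge0 u : 0 <= vol_form u u.
Proof. by rewrite !vol_formE (sesq_ge0 (vol_int_add nd) (@vol_int_ge0 R a)). Qed.

Lemma vol_form_definite u : vol_form u u = 0 -> u = 0.
Proof.
rewrite vol_formE => u0; apply/rowP => k; rewrite mxE.
apply: (vol_int_eq0 nd).
exact: (sesq_coord_eq0 (vol_int_add nd) (@vol_int_ge0 R a) u0).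
Qed.

(** The other argument is tangential, so only the tangential component matters. *)
Lemma face_form_tan i u v :
  face_form i (pncross i u) (ptan i v) = face_form i (pncross i u) v.
Proof.
transitivity (face_form i (pncross i (pncross i u)) (pncross i v)).
  by rewrite /ptan face_formNr (face_form_pncross i (pncross i u)).
by apply: oppr_inj; rewrite -face_form_pncross pncross_cube face_formNl.
Qed.

Lemma pconj_mderiv k P : pconj (mderiv k P) = mderiv k (pconj P).
Proof.
rewrite !pconjE; apply/mpolyP => m.
by rewrite mcoeff_mderiv !mcoeff_map_mpoly mcoeff_mderiv (raddfMn (@conjc R)).
Qed.

Lemma vconj_curl u : vconj (curl u) = curl (vconj u).
Proof. by apply/rowP => k; rewrite !mxE pconjB !pconj_mderiv. Qed.

Lemma face_int_sum i (I : finType) (F : I -> pol) :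
  face_int a i (\sum_k F k) = \sum_k face_int a i (F k).
Proof.
apply: (big_morph (face_int a i) (face_int_add i)).
by rewrite -[X in face_int a i X](scale0r (0 : pol)) face_int_scale mul0r.
Qed.

(** The divergence theorem applied to the cross product of u and the conjugate of
    v; its normal component is the product of n x u with the conjugate of v. *)
Lemma curl_by_parts u v :
  vol_form (curl u) v = vol_form u (curl v) + \sum_i face_form i (pncross i u) v.
Proof.
have divE : \sum_k mderiv k (cross u (vconj v) 0 k) =
    dot (curl u) (vconj v) - dot u (curl (vconj v)).
  by apply: (@div_cross _ (@mderiv 3 C)) => [k|k x y]; [exact: mderivB|exact: mderivM].
have := congr1 (vol_int a) divE; rewrite vol_int_sum//.
under eq_bigr do rewrite divergence//.
rewrite exchange_big /= -scaleN1r vol_int_add// vol_int_scale// mulN1r => E.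
rewrite !vol_formE /sesq vconj_curl.
have -> : \sum_i face_form i (pncross i u) v =
    \sum_i \sum_k (face_normal a i 0 k)%:C * face_int a i (cross u (vconj v) 0 k).
  apply: eq_bigr => i _.
  rewrite face_formE /sesq pncrossE dot_cross_triple /dot face_int_sum.
  by apply: eq_bigr => k _; rewrite pnormalE !mxE mul_mpolyC face_int_scale.
by rewrite E subrKC.
Qed.
End FaceForms.

(** * Degrees of fields *)

Section FieldDegree.
Variable R : realType.
Local Notation C := R[i].
Implicit Types (u v : vpoly R) (c : C) (s : nat).

Definition vsize_le s v : Prop := forall k, (msize (v 0%R k) <= s)%N.

Lemma vsize_leD s u v : vsize_le s u -> vsize_le s v -> vsize_le s (u + v).
Proof.
move=> us vs k; rewrite mxE; apply: leq_trans (msizeD_le _ _) _.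
by rewrite geq_max us vs.
Qed.

Lemma vsize_leZ s c v : vsize_le s v -> vsize_le s (vscale c v).
Proof.
by move=> vs k; rewrite vscaleE mxE mul_mpolyC; apply: leq_trans (msizeZ_le _ _) (vs k).
Qed.

Lemma vsize_leN s v : vsize_le s v -> vsize_le s (- v).
Proof. by move=> vs; rewrite -vscaleN1; exact: vsize_leZ. Qed.

Lemma vsize_le_curl s v : vsize_le s.+1 v -> vsize_le s (curl v).
Proof.
move=> vs k; rewrite mxE; apply: leq_trans (msizeD_le _ _) _.
by rewrite msizeN geq_max !msize_mderiv.
Qed.

Lemma vsize_leW s v : vsize_le s v -> vsize_le s.+1 v.
Proof. by move=> vs k; exact: leqW. Qed.

Lemma vscaleA c d v : vscale c (vscale d v) = vscale (c * d) v.
Proof. by rewrite !vscaleE scalerA -mpolyCM. Qed.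

Lemma vscale1 v : vscale 1 v = v.
Proof. by rewrite !vscaleE mpolyC1 scale1r. Qed.

Lemma vscaleDr c u v : vscale c (u + v) = vscale c u + vscale c v.
Proof. by rewrite !vscaleE scalerDr. Qed.

(** Each field is a multiple of the curl of the other, and the curl lowers the
    degree: the degree can be lowered until nothing is left. *)
Lemma curl_eigen_eq0 s c d u v : c != 0 -> d != 0 ->
  vscale c u = curl v -> vscale d v = curl u ->
  vsize_le s u -> vsize_le s v -> u = 0 /\ v = 0.
Proof.
move=> c0 d0 cu dv; elim: s => [|s IH] us vs.
  by split; apply/rowP => k; rewrite mxE; apply/eqP;
    rewrite -msize_poly_eq0 -leqn0.
apply: IH.
  by rewrite -[u]vscale1 -(mulVf c0) -vscaleA cu; apply/vsize_leZ/vsize_le_curl.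
by rewrite -[v]vscale1 -(mulVf d0) -vscaleA dv; apply/vsize_leZ/vsize_le_curl.
Qed.
End FieldDegree.

(** * The energy identity and uniqueness *)

Section LocalOperator.
Variables (R : realType) (kappa : R) (p : nat) (a : 'I_4 -> 'rV[R]_3).
Hypothesis kappa_gt0 : 0 < kappa.
Hypothesis nd : tetra_nondegenerate a.
Local Notation C := R[i].
Implicit Types (e h u v w : vpoly R) (c : C) (i : 'I_4).
Local Notation vol_form := (vol_form a).
Local Notation face_form := (face_form a).
Local Notation pncross := (pncross a).
Local Notation ptan := (ptan a).
Local Notation ik := (0 +i* kappa : C).

Definition lhs1 e h v : C := ik * vol_form e v - vol_form h (curl v)
  + \sum_i face_form i (vscale 2^-1 (ptan i e - pncross i h)) (ptan i v).

Definition lhs2 e h w : C := ik * vol_form h w + vol_form e (curl w)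
  + \sum_i face_form i (vscale 2^-1 (pncross i (ptan i e - pncross i h))) (ptan i w).

Lemma ik_neq0 : ik != 0.
Proof. by rewrite eq_complex /= eqxx gt_eqF. Qed.

Lemma conj_face_sum (F : 'I_4 -> C) : conjc (\sum_i F i) = \sum_i conjc (F i).
Proof. exact: (rmorph_sum (@conjc R)). Qed.

(** With e and h themselves as test fields, the boundary terms contain the mixed
    products of n x h with e, once directly and once conjugated. *)
Lemma boundary_terms e h :
  \sum_i face_form i (vscale 2^-1 (ptan i e - pncross i h)) (ptan i e) =
    2^-1 * (\sum_i face_form i (ptan i e) (ptan i e)
            - \sum_i face_form i (pncross i h) e) /\
  \sum_i face_form i (vscale 2^-1 (pncross i (ptan i e - pncross i h))) (ptan i h) =
    2^-1 * (\sum_i face_form i (ptan i h) (ptan i h)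
            - conjc (\sum_i face_form i (pncross i h) e)).
Proof.
rewrite conj_face_sum -!sumrB !mulr_sumr; split; apply: eq_bigr => i _.
  by rewrite face_formZl face_formDl face_formNl face_form_tan.
rewrite face_formZl pncrossD pncrossN pncross_ptan// -/(ptan i h) face_formDl.
rewrite face_form_tan// face_form_pncross// addrC; congr (_ * (_ - _)).
exact: face_form_herm.
Qed.

(** In the real part of the sum of the two equations, the terms in i kappa
    disappear, and integration by parts turns the curl terms into the real part
    of the mixed products of [boundary_terms], which cancel. Half the sum of the
    squared tangential components remains. *)
Lemma energy_identity e h : lhs1 e h e = 0 -> lhs2 e h h = 0 ->
  \sum_i face_form i (ptan i e) (ptan i e)
  + \sum_i face_form i (ptan i h) (ptan i h) = 0.
Proof.
have [B1 B2] := boundary_terms e h.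
rewrite /lhs1 /lhs2 {}B1 {}B2 (vol_form_herm nd (curl h) e) (curl_by_parts nd h e).
have TE : 0 <= \sum_i face_form i (ptan i e) (ptan i e).
  by apply: sumr_ge0 => i _; exact: face_form_ge0.
have TH : 0 <= \sum_i face_form i (ptan i h) (ptan i h).
  by apply: sumr_ge0 => i _; exact: face_form_ge0.
move: (vol_form_ge0 nd e) (vol_form_ge0 nd h) TE TH.
set A := vol_form e e; set B := vol_form h h; set x := vol_form h _.
set s := \sum_i face_form i (pncross i h) e.
move: (\sum_i face_form i (ptan i e) _) (\sum_i face_form i (ptan i h) _) A B x s.
move=> [t1 t2] [u1 u2] [A1 A2] [B1 B2] [x1 x2] [s1 s2].
have halfE : (2^-1 : C) = (2^-1)%:C by rewrite fmorphV rmorph_nat.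
rewrite halfE !lecE /= => /andP[/eqP -> _] /andP[/eqP -> _].
move=> /andP[/eqP -> _] /andP[/eqP -> _].
move=> /eqP; rewrite eq_complex /= => /andP[/eqP E1 _].
move=> /eqP; rewrite eq_complex /= => /andP[/eqP E2 _].
apply/eqP; rewrite eq_complex /= addr0 eqxx andbT; apply/eqP.
lra.
Qed.

(** By the energy identity the tangential components of e and h vanish on each
    face. Then nothing is left of the boundary terms, and the curl can be moved
    freely between the two arguments of the volume form. So i kappa e - curl h is
    orthogonal to all fields of degree at most p, itself included; in the same
    way i kappa h + curl e = 0. *)
Lemma homogeneous_eq0 e h : vpoly_deg_le p e -> vpoly_deg_le p h ->
  (forall v, vpoly_deg_le p v -> lhs1 e h v = 0) ->
  (forall w, vpoly_deg_le p w -> lhs2 e h w = 0) -> e = 0 /\ h = 0.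
Proof.
move=> de dh H1 H2.
have T_ge0 u : 0 <= \sum_i face_form i (ptan i u) (ptan i u).
  by apply: sumr_ge0 => i _; exact: face_form_ge0.
have /eqP := energy_identity (H1 e de) (H2 h dh).
rewrite paddr_eq0// => /andP[/eqP Te0 /eqP Th0].
have T0 u i v : \sum_i face_form i (ptan i u) (ptan i u) = 0 ->
    face_form i (ptan i u) v = 0.
  move=> S0; apply: face_form_isotropic; apply/eqP.
  move/eqP: S0; rewrite psumr_eq0; last by move=> j _; exact: face_form_ge0.
  by move=> /allP/(_ i (mem_index_enum i)).
have N0 u i v : \sum_i face_form i (ptan i u) (ptan i u) = 0 ->
    face_form i (pncross i u) v = 0.
  by move=> S0; rewrite -(pncross_ptan nd) face_form_pncross T0 ?oppr0.
have curl_skew u v : \sum_i face_form i (ptan i u) (ptan i u) = 0 ->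
    vol_form u (curl v) = vol_form (curl u) v.
  by move=> S0; rewrite curl_by_parts// big1 ?addr0// => i _; exact: N0.
have E1 : vscale ik e = curl h.
  apply/eqP; rewrite -subr_eq0; apply/eqP; apply: (vol_form_definite nd).
  set v := _ - _; have dv : vpoly_deg_le p v.
    by apply: vsize_leD; [exact: vsize_leZ|apply/vsize_leN/vsize_leW/vsize_le_curl].
  have := H1 v dv; rewrite /lhs1 big1 ?addr0 => [|i _]; last first.
    by rewrite face_formZl face_formDl face_formNl T0// N0// subrr mulr0.
  by rewrite curl_skew// -vol_formZl// -vol_formNl// -vol_formDl.
have E2 : vscale (- ik) h = curl e.
  apply/eqP; rewrite -subr_eq0; apply/eqP; apply: (vol_form_definite nd).
  set v := _ - _; have dv : vpoly_deg_le p v.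
    by apply: vsize_leD; [exact: vsize_leZ|apply/vsize_leN/vsize_leW/vsize_le_curl].
  have := H2 v dv; rewrite /lhs2 big1 ?addr0 => [|i _]; last first.
    rewrite face_formZl pncrossD pncrossN pncross_ptan// face_formDl N0// add0r.
    by rewrite -/(ptan i h) T0// mulr0.
  rewrite curl_skew// => E; rewrite vol_formDl// vol_formNl// vol_formZl// mulNr.
  by rewrite -opprD E oppr0.
by apply: curl_eigen_eq0 E1 E2 de dh; rewrite ?oppr_eq0 ik_neq0.
Qed.
End LocalOperator.

(** * Finite-dimensional reduction *)

(** A square matrix of full rank is invertible. *)
Lemma injective_system_solvable (F : fieldType) (J : finType) (A : J -> J -> F) :
  (forall c : J -> F, (forall j', \sum_j c j * A j j' = 0) -> forall j, c j = 0) ->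
  forall b : J -> F, exists c : J -> F, forall j', \sum_j c j * A j j' = b j'.
Proof.
move=> inj b; pose M := \matrix_(i < #|J|, k < #|J|) A (enum_val i) (enum_val k).
have mulE (x : 'rV_#|J|) k : (x *m M) 0 (enum_rank k) =
    \sum_j x 0 (enum_rank j) * A j k.
  rewrite mxE (reindex_onto enum_rank enum_val) => [|i _]; last by rewrite enum_valK.
  rewrite (eq_bigl predT) => [|j]; last by rewrite enum_rankK eqxx.
  by apply: eq_bigr => j _; rewrite mxE !enum_rankK.
have Mu : M \in unitmx.
  rewrite -row_free_unit -kermx_eq0; apply/eqP/row_matrixP => i.
  rewrite row0; set x := row i _.
  have xM : x *m M = 0 by rewrite /x -row_mul mulmx_ker row0.
  have x0 j : x 0 (enum_rank j) = 0.
    by apply: (inj (fun j => x 0 (enum_rank j))) => k; rewrite -mulE xM mxE.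
  by apply/rowP => k; rewrite -[k]enum_valK x0 mxE.
exists (fun j => ((\row_i b (enum_val i)) *m invmx M) 0 (enum_rank j)) => k.
by rewrite -mulE mulmxKV// mxE enum_rankK.
Qed.

Section FieldBasis.
Variables (R : realType) (p : nat).
Local Notation C := R[i].
Definition field_index : Type := ('I_3 * bmultinom 3 p.+1)%type.
HB.instance Definition _ := Finite.on field_index.

Definition field_basis (j : field_index) : vpoly R :=
  mpolyX C (bmnm j.2) *: delta_mx 0 j.1.

Definition field_coord (v : vpoly R) (j : field_index) : C :=
  mcoeff (bmnm j.2) (v 0 j.1).

Lemma field_basis_size j : vsize_le p.+1 (field_basis j).
Proof.
case: j => k [m mp] l; rewrite !mxE eqxx /=; case: (l == k).
  by rewrite mulr1 msizeX.
by rewrite mulr0 msize0.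
Qed.

Lemma vsize_le_sum (J : finType) s (F : J -> vpoly R) :
  (forall j, vsize_le s (F j)) -> vsize_le s (\sum_j F j).
Proof.
move=> Fs; elim/big_ind: _ => //; last by move=> u v; exact: vsize_leD.
by move=> k; rewrite mxE msize0.
Qed.

Lemma field_expansion v : vsize_le p.+1 v ->
  v = \sum_j vscale (field_coord v j) (field_basis j).
Proof.
move=> vp; apply/rowP => l; rewrite summxE.
rewrite (eq_bigr (fun j : field_index => (l == j.1)%:R *
    (mcoeff (bmnm j.2) (v 0 l) *: mpolyX C (bmnm j.2)))); last first.
  move=> [k m] _; rewrite vscaleE !mxE eqxx /= /field_coord /=.
  have [->|_] := eqVneq l k; last by rewrite !mulr0 mul0r.
  by rewrite mulr1 mul1r mul_mpolyC.
rewrite -(pair_bigA _ (fun k m => (l == k)%:R *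
    (mcoeff (bmnm m) (v 0 l) *: mpolyX C (bmnm m)))) /=.
rewrite (bigD1 l)//= [X in _ + X]big1 ?addr0 => [|k kl]; last first.
  by rewrite big1// => m _; rewrite eq_sym (negbTE kl) mul0r.
rewrite {1}(mpolywE (vp l)); apply: eq_bigr => m _.
by rewrite eqxx mul1r.
Qed.

Lemma field_coord_sum (c : field_index -> C) j :
  field_coord (\sum_i vscale (c i) (field_basis i)) j = c j.
Proof.
case: j => l m; rewrite /field_coord summxE raddf_sum /= (bigD1 (l, m))//=.
rewrite big1 ?addr0 => [|[k n] kn].
  by rewrite vscaleE !mxE eqxx /= eqxx mulr1 mul_mpolyC mcoeffZ mcoeffX eqxx mulr1.
rewrite vscaleE !mxE eqxx /=; have [lk|_] := eqVneq l k; last by rewrite !mulr0 mcoeff0.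
rewrite mulr1 mul_mpolyC mcoeffZ mcoeffX [_ == _](_ : _ = false) ?mulr0//.
apply/negbTE; apply: contra kn => /eqP nm; rewrite lk; apply/eqP; congr (_, _).
exact/val_inj.
Qed.
End FieldBasis.

(** * Linearity of the local problem in the fields *)

Lemma regroup_sub (A : comPzRingType) (x c y z s y' z' s' : A) :
  x * (c * y + y') - (c * z + z') + (c * s + s') =
  c * (x * y - z + s) + (x * y' - z' + s').
Proof. by ring. Qed.

Lemma regroup_add (A : comPzRingType) (x c y z s y' z' s' : A) :
  x * (c * y + y') + (c * z + z') + (c * s + s') =
  c * (x * y + z + s) + (x * y' + z' + s').
Proof. by ring. Qed.

Section LocalLinearity.
Variables (R : realType) (kappa : R) (p : nat) (a : 'I_4 -> 'rV[R]_3).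
Hypothesis nd : tetra_nondegenerate a.
Local Notation C := R[i].
Implicit Types (e h u v w : vpoly R) (c : C) (i : 'I_4).
Local Notation lhs1 := (lhs1 kappa a).
Local Notation lhs2 := (lhs2 kappa a).

Lemma curlD u v : curl (u + v) = curl u + curl v.
Proof. by apply/rowP => k; rewrite !mxE !mderivD; ring. Qed.

Lemma curlZ c u : curl (vscale c u) = vscale c (curl u).
Proof. by rewrite !vscaleE; apply/rowP => k; rewrite !mxE !mderiv_mulC mulrBr. Qed.

Definition surf1 e h v : C :=
  \sum_i face_form a i (vscale 2^-1 (ptan a i e - pncross a i h)) (ptan a i v).

Definition surf2 e h w : C := \sum_i face_form a i
  (vscale 2^-1 (pncross a i (ptan a i e - pncross a i h))) (ptan a i w).

Lemma vscaleC c d u : vscale c (vscale d u) = vscale d (vscale c u).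
Proof. by rewrite !vscaleA mulrC. Qed.

Lemma gplus_linear i c e h e' h' :
  ptan a i (vscale c e + e') - pncross a i (vscale c h + h') =
  vscale c (ptan a i e - pncross a i h) + (ptan a i e' - pncross a i h').
Proof.
rewrite ptanD pncrossD ptanZ pncrossZ opprD addrACA; congr (_ + _).
by rewrite -!vscaleN1 vscaleC -vscaleDr.
Qed.

Lemma surf1_linear c e h e' h' v :
  surf1 (vscale c e + e') (vscale c h + h') v = c * surf1 e h v + surf1 e' h' v.
Proof.
rewrite /surf1 mulr_sumr -big_split; apply: eq_bigr => i _ /=.
by rewrite gplus_linear vscaleDr vscaleC face_formDl (face_formZl a i c).
Qed.

Lemma surf2_linear c e h e' h' v :
  surf2 (vscale c e + e') (vscale c h + h') v = c * surf2 e h v + surf2 e' h' v.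
Proof.
rewrite /surf2 mulr_sumr -big_split; apply: eq_bigr => i _ /=.
rewrite gplus_linear pncrossD pncrossZ vscaleDr vscaleC.
by rewrite face_formDl (face_formZl a i c).
Qed.

Lemma face_form_tan_antilinear i c u v v' :
  face_form a i u (ptan a i (vscale c v + v')) =
  conjc c * face_form a i u (ptan a i v) + face_form a i u (ptan a i v').
Proof. by rewrite ptanD ptanZ face_formDr face_formZr. Qed.

Lemma surf1_antilinear e h c v v' :
  surf1 e h (vscale c v + v') = conjc c * surf1 e h v + surf1 e h v'.
Proof.
rewrite /surf1 mulr_sumr -big_split; apply: eq_bigr => i _ /=.
exact: face_form_tan_antilinear.
Qed.

Lemma surf2_antilinear e h c v v' :
  surf2 e h (vscale c v + v') = conjc c * surf2 e h v + surf2 e h v'.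
Proof.
rewrite /surf2 mulr_sumr -big_split; apply: eq_bigr => i _ /=.
exact: face_form_tan_antilinear.
Qed.

Lemma lhs1_linear c e h e' h' v :
  lhs1 (vscale c e + e') (vscale c h + h') v = c * lhs1 e h v + lhs1 e' h' v.
Proof.
rewrite /lhs1 -!/(surf1 _ _ _) surf1_linear !vol_formDl// !vol_formZl//.
exact: regroup_sub.
Qed.

Lemma lhs1_antilinear e h c v v' :
  lhs1 e h (vscale c v + v') = conjc c * lhs1 e h v + lhs1 e h v'.
Proof.
rewrite /lhs1 -!/(surf1 _ _ _) surf1_antilinear curlD curlZ !vol_formDr// !vol_formZr//.
exact: regroup_sub.
Qed.

Lemma lhs2_linear c e h e' h' v :
  lhs2 (vscale c e + e') (vscale c h + h') v = c * lhs2 e h v + lhs2 e' h' v.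
Proof.
rewrite /lhs2 -!/(surf2 _ _ _) surf2_linear !vol_formDl// !vol_formZl//.
exact: regroup_add.
Qed.

Lemma lhs2_antilinear e h c v v' :
  lhs2 e h (vscale c v + v') = conjc c * lhs2 e h v + lhs2 e h v'.
Proof.
rewrite /lhs2 -!/(surf2 _ _ _) surf2_antilinear curlD curlZ !vol_formDr// !vol_formZr//.
exact: regroup_add.
Qed.
End LocalLinearity.

(** * From integrals to forms on polynomial fields *)

Section Translation.
Variables (R : realType) (kappa : R) (p : nat) (a : 'I_4 -> 'rV[R]_3).
Hypothesis nd : tetra_nondegenerate a.
Local Notation C := R[i].
Implicit Types (e h u v w : vpoly R) (c : C) (i : 'I_4) (x : 'rV[R]_3).

Lemma vevalE v x k : veval v x 0 k = peval (v 0 k) x.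
Proof. by rewrite mxE pevalE. Qed.

Lemma vevalN v x : veval (- v) x = - veval v x.
Proof. by apply/rowP => k; rewrite vevalE !mxE pevalN pevalE. Qed.

Lemma vevalB u v x : veval (u - v) x = veval u x - veval v x.
Proof. by apply/rowP => k; rewrite vevalE !mxE pevalB !pevalE. Qed.

Lemma veval_scale c v x : veval (vscale c v) x = c *: veval v x.
Proof. by apply/rowP => k; rewrite vscaleE vevalE !mxE pevalM pevalC pevalE. Qed.

Lemma veval_ncross i v x : veval (pncross a i v) x = ncross a i (veval v x).
Proof.
rewrite pncrossE pnormalE; apply/rowP => k; rewrite vevalE /ncross !mxE pevalB !pevalM.
by rewrite !pevalC -!pevalE.
Qed.

Lemma veval_tan i v x : veval (ptan a i v) x = tan_comp a i (veval v x).
Proof. by rewrite /ptan vevalN !veval_ncross. Qed.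

Lemma veval_dot u v x :
  dot (veval u x) (map_mx (@conjc R) (veval v x)) = peval (dot u (vconj v)) x.
Proof.
rewrite /dot peval_sum; apply: eq_bigr => k _.
by rewrite pevalM !mxE peval_conj !pevalE.
Qed.

Lemma eq_Cintegral d (T : measurableType d) (m : {measure set T -> \bar R})
    (D : set T) (f g : T -> C) : (forall t, D t -> f t = g t) ->
  Cintegral m D f = Cintegral m D g.
Proof.
by move=> fg; rewrite /Cintegral; congr (_ +i* _);
  apply: eq_Rintegral => t /set_mem /fg ->.
Qed.

Lemma inner_volE u v : inner_vol a (veval u) (veval v) = vol_form a u v.
Proof.
rewrite vol_formE; apply: eq_Cintegral => t _; exact: veval_dot.
Qed.

(** Only the values on the face count, so data given by functions can be
    replaced by polynomial fields. *)
Lemma inner_faceE i (f g : 'rV[R]_3 -> 'rV[C]_3) u v :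
  (forall x, face a i x -> f x = veval u x) ->
  (forall x, face a i x -> g x = veval v x) ->
  inner_face a i f g = face_form a i u v.
Proof.
move=> fu gv; rewrite face_formE; congr (_ * _); apply: eq_Cintegral => s Ts /=.
have Fs := face_param_in_face a i Ts.
by rewrite fu// gv// veval_dot.
Qed.
End Translation.

Lemma iff_eq_add (V : nmodType) (x s s' t t' : V) : s = s' -> t = t' ->
  (x + s = t <-> x + s' = t').
Proof. by move=> -> ->. Qed.

(** * The linear system of the local problem *)

Section LocalSystem.
Variables (R : realType) (kappa : R) (p : nat) (a : 'I_4 -> 'rV[R]_3).
Hypothesis nd : tetra_nondegenerate a.
Local Notation C := R[i].
Implicit Types (e h u v w : vpoly R) (i : 'I_4) (x : 'rV[R]_3).
Local Notation lhs1 := (lhs1 kappa a).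
Local Notation lhs2 := (lhs2 kappa a).

(** The data enter through polynomial fields q_i extending them from the faces. *)
Definition rhs1 (q : 'I_4 -> vpoly R) v : C :=
  \sum_i face_form a i (vscale 2^-1 (q i)) (ptan a i v).

Definition rhs2 (q : 'I_4 -> vpoly R) w : C :=
  - \sum_i face_form a i (vscale 2^-1 (pncross a i (q i))) (ptan a i w).

Lemma gplus_veval i e h x : gplus a i e h x = veval (ptan a i e - pncross a i h) x.
Proof. by rewrite vevalB veval_tan veval_ncross. Qed.

Lemma local_eq1E g (q : 'I_4 -> vpoly R) e h v :
  (forall i, {in face a i, g i =1 veval (q i)}) ->
  local_eq1 kappa a g e h v <-> lhs1 e h v = rhs1 q v.
Proof.
move=> gq; rewrite /local_eq1 !inner_volE /lhs1 /rhs1.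
apply: iff_eq_add; apply: eq_bigr => i _; apply: inner_faceE => x Fx.
- by rewrite veval_scale gplus_veval.
- by rewrite veval_tan.
- by rewrite veval_scale gq ?inE.
- by rewrite veval_tan.
Qed.

Lemma local_eq2E g (q : 'I_4 -> vpoly R) e h w :
  (forall i, {in face a i, g i =1 veval (q i)}) ->
  local_eq2 kappa a g e h w <-> lhs2 e h w = rhs2 q w.
Proof.
move=> gq; rewrite /local_eq2 !inner_volE /lhs2 /rhs2.
apply: iff_eq_add; last congr (- _); apply: eq_bigr => i _; apply: inner_faceE => x Fx.
- by rewrite veval_scale gplus_veval veval_ncross.
- by rewrite veval_tan.
- by rewrite veval_scale veval_ncross gq ?inE.
- by rewrite veval_tan.
Qed.

Lemma rhs1_antilinear q c v v' :
  rhs1 q (vscale c v + v') = conjc c * rhs1 q v + rhs1 q v'.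
Proof.
rewrite /rhs1 mulr_sumr -big_split; apply: eq_bigr => i _ /=.
exact: face_form_tan_antilinear.
Qed.

Lemma rhs2_antilinear q c v v' :
  rhs2 q (vscale c v + v') = conjc c * rhs2 q v + rhs2 q v'.
Proof.
rewrite /rhs2 mulrN -opprD mulr_sumr -big_split; congr (- _).
apply: eq_bigr => i _ /=; exact: face_form_tan_antilinear.
Qed.

(** It suffices to test the equations with basis fields. *)
Lemma antilinear_eq_on_basis (f f' : vpoly R -> C) :
  (forall c v v', f (vscale c v + v') = conjc c * f v + f v') ->
  (forall c v v', f' (vscale c v + v') = conjc c * f' v + f' v') ->
  (forall j : field_index p, f (field_basis R j) = f' (field_basis R j)) ->
  forall v, vpoly_deg_le p v -> f v = f' v.
Proof.
move=> fA fA' ff' v dv.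
have f0 (F : vpoly R -> C) :
    (forall c v v', F (vscale c v + v') = conjc c * F v + F v') -> F 0 = 0.
  move=> FA; have := FA 1 0 0; rewrite vscale1 addr0 conjc1 mul1r => /eqP.
  by rewrite -subr_eq subrr eq_sym => /eqP.
rewrite (field_expansion dv); elim/big_ind: _ => [|u w Eu Ew|j _].
- by rewrite !f0.
- by rewrite -[u]vscale1 fA fA' Ew Eu.
- by rewrite -[vscale _ _]addr0 fA fA' ff' !f0.
Qed.

(** The unknown is a pair of fields and there are two equations: basis fields in
    the first slot are matched with tests of the first equation, and those in the
    second slot with tests of the second one. *)
Definition trial (j : field_index p + field_index p) : vpoly R * vpoly R :=
  match j with inl i => (field_basis R i, 0) | inr i => (0, field_basis R i) end.

Definition system_matrix (j k : field_index p + field_index p) : C :=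
  match k with
  | inl i => lhs1 (trial j).1 (trial j).2 (field_basis R i)
  | inr i => lhs2 (trial j).1 (trial j).2 (field_basis R i)
  end.

Definition trial_sum (c : field_index p + field_index p -> C) : vpoly R * vpoly R :=
  (\sum_j vscale (c j) (trial j).1, \sum_j vscale (c j) (trial j).2).

Lemma trial_sumE (c : field_index p + field_index p -> C) : trial_sum c =
  (\sum_i vscale (c (inl i)) (field_basis R i),
   \sum_i vscale (c (inr i)) (field_basis R i)).
Proof.
have v0 d : vscale d 0 = 0 :> vpoly R by rewrite vscaleE scaler0.
rewrite /trial_sum; congr (_, _); rewrite big_sumType /=.
  by rewrite [X in _ + X]big1 ?addr0.
by rewrite [X in X + _]big1 ?add0r.
Qed.

Lemma trial_sum_size (c : field_index p + field_index p -> C) :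
  vpoly_deg_le p (trial_sum c).1 /\ vpoly_deg_le p (trial_sum c).2.
Proof.
by rewrite trial_sumE; split; apply: vsize_le_sum => i; apply: vsize_leZ;
  exact: field_basis_size.
Qed.

Lemma bilinear_trial_sum (f : vpoly R -> vpoly R -> C) c :
  (forall c e h e' h', f (vscale c e + e') (vscale c h + h') = c * f e h + f e' h') ->
  f (trial_sum c).1 (trial_sum c).2 = \sum_j c j * f (trial j).1 (trial j).2.
Proof.
move=> fL; have f00 : f 0 0 = 0.
  have := fL 1 0 0 0 0; rewrite vscale1 addr0 mul1r => /eqP.
  by rewrite -subr_eq subrr eq_sym => /eqP.
rewrite /trial_sum /=; elim/big_rec3: _ => [//|j x e h _ <-].
exact: fL.
Qed.

Lemma trial_sum_system c k : \sum_j c j * system_matrix j k =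
  match k with
  | inl i => lhs1 (trial_sum c).1 (trial_sum c).2 (field_basis R i)
  | inr i => lhs2 (trial_sum c).1 (trial_sum c).2 (field_basis R i)
  end.
Proof.
case: k => i; apply/esym.
  apply: (@bilinear_trial_sum (fun e h => lhs1 e h (field_basis R i))) => *.
  exact: lhs1_linear.
apply: (@bilinear_trial_sum (fun e h => lhs2 e h (field_basis R i))) => *.
exact: lhs2_linear.
Qed.
End LocalSystem.

Theorem theorem3p1 (R : realType) (kappa : R) (p : nat)
    (a : 'I_4 -> 'rV[R]_3) (g : 'I_4 -> 'rV[R]_3 -> 'rV[R[i]]_3)
    (kappa_gt0 : 0 < kappa) (a_nondeg : tetra_nondegenerate a)
    (g_tan : forall i, tangential_poly p a i (g i)) :
  exists! eh : vpoly R * vpoly R, local_solution kappa p a g eh.1 eh.2.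
Proof.
have /choice[q gq] : forall i, exists q : vpoly R, {in face a i, g i =1 veval q}.
  by move=> i; have [[q [_ gq]] _] := g_tan i; exists q.
have solE e h : local_solution kappa p a g e h <->
  [/\ vpoly_deg_le p e, vpoly_deg_le p h,
      forall v, vpoly_deg_le p v -> lhs1 kappa a e h v = rhs1 a q v &
      forall w, vpoly_deg_le p w -> lhs2 kappa a e h w = rhs2 a q w].
  split=> [[de dh S]|[de dh S1 S2]]; split=> // v.
  - by move=> dv; have [/(local_eq1E _ _ _ _ gq)] := S v v dv dv.
  - by move=> dv; have [_ /(local_eq2E _ _ _ _ gq)] := S v v dv dv.
  - by move=> w dv dw; split;
      [apply/(local_eq1E _ _ _ _ gq)/S1|apply/(local_eq2E _ _ _ _ gq)/S2].
pose A := @system_matrix R kappa p a.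
have inj (c : field_index p + field_index p -> R[i]) :
    (forall k, \sum_j c j * A j k = 0) -> forall j, c j = 0.
  move=> cA; have [d1 d2] := trial_sum_size c.
  have zeroA (c' : R[i]) (v v' : vpoly R) : 0 = conjc c' * 0 + 0 :> R[i].
    by rewrite mulr0 addr0.
  have [] := homogeneous_eq0 kappa_gt0 a_nondeg d1 d2.
  - apply: (@antilinear_eq_on_basis R p _ (fun=> 0)) => //.
      exact: lhs1_antilinear.
    by move=> i; have := cA (inl i); rewrite trial_sum_system.
  - apply: (@antilinear_eq_on_basis R p _ (fun=> 0)) => //.
      exact: lhs2_antilinear.
    by move=> i; have := cA (inr i); rewrite trial_sum_system.
  rewrite trial_sumE /= => e0 h0 [i|i].
    by rewrite -(field_coord_sum (fun i => c (inl i)) i) e0 /field_coord mxE mcoeff0.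
  by rewrite -(field_coord_sum (fun i => c (inr i)) i) h0 /field_coord mxE mcoeff0.
pose b (k : field_index p + field_index p) : R[i] :=
  match k with inl i => rhs1 a q (field_basis R i)
             | inr i => rhs2 a q (field_basis R i) end.
have [c cA] := injective_system_solvable inj b.
have [d1 d2] := trial_sum_size c.
have S1 v : vpoly_deg_le p v ->
    lhs1 kappa a (trial_sum c).1 (trial_sum c).2 v = rhs1 a q v.
  apply: antilinear_eq_on_basis; [exact: lhs1_antilinear|exact: rhs1_antilinear|].
  by move=> i; have := cA (inl i); rewrite trial_sum_system.
have S2 w : vpoly_deg_le p w ->
    lhs2 kappa a (trial_sum c).1 (trial_sum c).2 w = rhs2 a q w.
  apply: antilinear_eq_on_basis; [exact: lhs2_antilinear|exact: rhs2_antilinear|].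
  by move=> i; have := cA (inr i); rewrite trial_sum_system.
exists (trial_sum c); split; first exact/solE.
move=> [e h] /solE[/= de dh T1 T2].
(* the difference of two solutions solves the homogeneous problem *)
have dD (u v : vpoly R) : vpoly_deg_le p u -> vpoly_deg_le p v ->
    vpoly_deg_le p (vscale (-1) u + v).
  by move=> du dv; apply: vsize_leD => //; exact: vsize_leZ.
have [] := homogeneous_eq0 kappa_gt0 a_nondeg (dD _ _ de d1) (dD _ _ dh d2).
- by move=> v dv; rewrite lhs1_linear// S1// T1// mulN1r addNr.
- by move=> w dw; rewrite lhs2_linear// S2// T2// mulN1r addNr.
rewrite !vscaleN1 => /eqP; rewrite addrC subr_eq0 => /eqP e1 /eqP.
rewrite addrC subr_eq0 => /eqP h1.
by rewrite [trial_sum c]surjective_pairing e1 h1.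
Qed.
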